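(* The scheduler $\mathsf{nev}$ is a $1.5$-competitive never-committing scheduler for the One-Fast-Many-Slow Decision Problem.
   Context: One-Fast-Many-Slow Decision Problem: there is a single fast machine and an unlimited number of slow machines. An instance is a task arrival process (TAP) $\mathcal{T}=(\tau_1,\dots,\tau_n)$, where $\tau_i=(\sigma_i,\pi_i,t_i)$ gives the task's runtime $\sigma_i$ on a slow machine, its runtime $\pi_i$ on the fast machine, and its arrival time $t_i$, with $t_1\le\dots\le t_n$. A valid schedule assigns at most one task to each machine at each time, does no work on a task before its arrival time, runs each task on at most one machine, and runs each task $\tau_i$ either for a total of $\sigma_i$ time on some slow machine or for a total of $\pi_i$ time on the fast machine. The completion time is the time when the last task finishes. An online scheduler learns each task only at its arrival time. A never-committing scheduler may delay choosing a machine for a task and may at any time cancel a task, erasing all work previously done on it and allowing it to be reassigned to a new machine. A scheduler is $c$-competitive if on every TAP its completion time is at most $c$ times the minimum completion time of an offline valid schedule for that TAP. For $t\ge0$, $\mathcal{T}^t$ is the truncation of $\mathcal{T}$ to tasks with $t_i\le t$, and $C^t$ is the minimum completion time of any valid offline schedule for $\mathcal{T}^t$. The scheduler $\mathsf{nev}$ acts as follows at each time $t$: (1) if a task $\tau_i$ (arrived, not completed) has $\sigma_i+t\le 1.5\,C^t$ but is not currently running on a slow machine, start $\tau_i$ on a slow machine, cancelling its fast-machine implementation if necessary; (2) let $\mathcal{P}$ be the set of tasks that have arrived, are not completed, and are not running on a slow machine; choose $\tau_i\in\mathcal{P}$ maximizing $\sigma_i+t_i$, breaking ties by choosing the smaller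 index $i$, and run $\tau_i$ on the fast machine during this time step. *)

(* Defs.v *)
From HB Require Import structures.
From mathcomp Require Import all_boot all_order all_algebra.
From mathcomp Require Import all_classical all_reals all_analysis.
Import Order.TTheory GRing.Theory Num.Theory.
Import numFieldNormedType.Exports.

Set Implicit Arguments.
Unset Strict Implicit.
Unset Printing Implicit Defensive.

Local Open Scope classical_set_scope.
Local Open Scope ring_scope.

Record task (R : realType) := Task {
  slow_runtime : R; (* sigma *)
  fast_runtime : R; (* pi *)
  arrival : R       (* t *)
}.

Definition is_tap {R : realType} (T : seq (task R)) : bool :=
  all (fun tau => [&& 0 < slow_runtime tau, 0 < fast_runtime tau
                    & 0 <= arrival tau]) T
  && sorted (fun tau tau' => arrival tau <= arrival tau') T.

(* Tasks are designated by their index. The default value is never relevant: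
   every use below is guarded by [i < size T]. *)
Definition task_at {R : realType} (T : seq (task R)) (i : nat) : task R :=
  nth (Task 0 0 0) T i.

(* Arrival times are sorted, so this is a prefix of [T] and the remaining
   tasks keep their indices. *)
Definition truncation {R : realType} (T : seq (task R)) (t : R)
    : seq (task R) :=
  [seq tau <- T | arrival tau <= t].

Definition arrived {R : realType} (T : seq (task R)) (i : nat) (t : R) : Prop :=
  (i < size T)%N /\ arrival (task_at T i) <= t.

Inductive machine := Fast | Slow of nat.

Definition runtime {R : realType} (T : seq (task R)) (m : machine) (i : nat)
    : R :=
  match m with
  | Fast => fast_runtime (task_at T i)
  | Slow _ => slow_runtime (task_at T i)
  end.

(* Time is continuous and tasks may be preempted: each machine is assigned at
   most one task at each time, and the amount of work done is the Lebesgue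
   measure of the time during which the task is run. *)
Record schedule (R : realType) := Schedule {
  run :> machine -> R -> option nat;
  run_measurable : forall m i, measurable [set t : R | run m t = Some i]
}.

Definition total_work {R : realType} (S : schedule R) (m : machine) (i : nat)
    : \bar R :=
  lebesgue_measure [set t : R | S m t = Some i].

Definition work_by {R : realType} (S : schedule R) (m : machine) (i : nat)
    (t : R) : \bar R :=
  lebesgue_measure [set s : R | s < t /\ S m s = Some i].

Definition valid_schedule {R : realType} (T : seq (task R)) (S : schedule R)
    : Prop :=
  [/\ forall m i t, S m t = Some i -> arrived T i t,
      forall m m' i t t', S m t = Some i -> S m' t' = Some i -> m = m'
    & forall i, (i < size T)%N ->
        exists m, total_work S m i = (runtime T m i)%:E].

(* Equal to +oo if some task is not finished within finite time. *)
Definition completion_time {R : realType} (T : seq (task R)) (S : schedule R)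
    : \bar R :=
  ereal_inf [set c%:E | c in [set c : R | 0 <= c /\
    forall i, (i < size T)%N ->
      exists m, ((runtime T m i)%:E <= work_by S m i c)%E]].

Definition opt {R : realType} (T : seq (task R)) : \bar R :=
  ereal_inf [set completion_time T S | S in [set S | valid_schedule T S]].

(* [cancel E i] is the set of times at which task [i] is cancelled. A
   cancellation at time [c] erases the work done on [i] strictly before [c];
   work done from [c] on counts towards the new implementation. *)
Record execution (R : realType) := Execution {
  exec :> schedule R;
  cancel : nat -> set R
}.

Definition surviving_run {R : realType} (E : execution R) (m : machine) (s : R)
    : option nat :=
  if E m s is Some i then
    if `[< forall c, cancel E i c -> c <= s >] then Some i else None
  else None.

Lemma surviving_run_measurable {R : realType} (E : execution R) m i :
  measurable [set s : R | surviving_run E m s = Some i].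
Proof.
have -> : [set s : R | surviving_run E m s = Some i] =
    [set s : R | E m s = Some i] `&` [set s : R | forall c, cancel E i c -> c <= s].
  rewrite /surviving_run; apply/seteqP; split => s /=.
    case: (E m s) => // j; case: asboolP => // Hj [eij]; subst j.
    by split.
  by move=> [-> Hi]; rewrite asboolT.
apply: measurableI; first exact: run_measurable.
apply: measurable_realfun.is_interval_measurable => x y /= Hx _ z /andP[xz _] c Hc.
exact: le_trans (Hx c Hc) xz.
Qed.

(* The schedule that remains once all the cancelled work has been erased. *)
Definition surviving {R : realType} (E : execution R) : schedule R :=
  Schedule (surviving_run_measurable E).

(* The first two conditions also constrain the work that is erased later. *)
Definition valid_execution {R : realType} (T : seq (task R)) (E : execution R)
    : Prop :=
  [/\ forall m i t, E m t = Some i -> arrived T i t,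
      forall m m' i t t', t <= t' -> E m t = Some i -> E m' t' = Some i ->
        m <> m' -> exists c, [/\ t < c, c <= t' & cancel E i c]
    & valid_schedule T (surviving E)].

Definition scheduler (R : realType) := seq (task R) -> execution R.

(* What the scheduler does up to time [t] depends only on the tasks that have
   arrived by time [t]. *)
Definition online {R : realType} (A : scheduler R) : Prop :=
  forall (T T' : seq (task R)) (t : R), is_tap T -> is_tap T' ->
    truncation T t = truncation T' t ->
    forall s, s <= t ->
      (forall m, A T m s = A T' m s) /\
      (forall i, cancel (A T) i s <-> cancel (A T') i s).

Definition never_committing_scheduler {R : realType} (A : scheduler R)
    : Prop :=
  online A /\ forall T, is_tap T -> valid_execution T (A T).

Definition competitive {R : realType} (c : R) (A : scheduler R) : Prop :=
  forall T, is_tap T ->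
    (completion_time T (surviving (A T)) <= c%:E * opt T)%E.

(* Work available just before time [t]: what was done before [t] and was not
   erased by a cancellation occurring before [t]. *)
Definition progress {R : realType} (E : execution R) (m : machine) (i : nat)
    (t : R) : \bar R :=
  lebesgue_measure [set s : R | [/\ s < t, E m s = Some i
    & forall c, cancel E i c -> c < t -> c <= s]].

Definition completed {R : realType} (T : seq (task R)) (E : execution R)
    (i : nat) (t : R) : Prop :=
  exists m, ((runtime T m i)%:E <= progress E m i t)%E.

Definition pending {R : realType} (T : seq (task R)) (E : execution R)
    (i : nat) (t : R) : Prop :=
  arrived T i t /\ ~ completed T E i t.

Definition slow_safe {R : realType} (T : seq (task R)) (E : execution R)
    (i : nat) (t : R) : Prop :=
  pending T E i t /\
  ((slow_runtime (task_at T i) + t)%:E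
     <= (3 / 2)%:E * opt (truncation T t))%E.

(* nev never interrupts a task running on a slow machine: such a task runs from
   the first time at which it is [slow_safe] until it is completed. *)
Definition starts_slow {R : realType} (T : seq (task R)) (E : execution R)
    (i : nat) (t : R) : Prop :=
  slow_safe T E i t /\ forall s, s < t -> ~ slow_safe T E i s.

Definition running_slow {R : realType} (T : seq (task R)) (E : execution R)
    (i : nat) (t : R) : Prop :=
  pending T E i t /\ exists2 s, s <= t & starts_slow T E i s.

Definition fast_candidate {R : realType} (T : seq (task R)) (E : execution R)
    (i : nat) (t : R) : Prop :=
  pending T E i t /\ ~ running_slow T E i t.

Definition fast_choice {R : realType} (T : seq (task R)) (E : execution R)
    (i : nat) (t : R) : Prop :=
  fast_candidate T E i t /\
  forall j, fast_candidate T E j t ->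
    let key k := slow_runtime (task_at T k) + arrival (task_at T k) in
    key j < key i \/ key j = key i /\ (i <= j)%N.

(* [E] obeys the rules of nev at all times. The slow machines being unlimited
   in number and identical, task [i] uses the slow machine of number [i]. A
   cancellation takes place at each slow start; it has no effect if no work has
   been done on the fast machine. *)
Definition nev_execution {R : realType} (T : seq (task R)) (E : execution R)
    : Prop :=
  forall t i,
    [/\ cancel E i t <-> starts_slow T E i t,
        forall k, E (Slow k) t = Some i <-> k = i /\ running_slow T E i t
      & E Fast t = Some i <-> fast_choice T E i t].

Definition is_nev {R : realType} (A : scheduler R) : Prop :=
  forall T, is_tap T -> nev_execution T (A T).

(* Main.v *)
(* The tasks run by nev on slow machines finish by [3/2 * C], where [C] is the
   optimal completion time, because of the condition under which they start.
   Call [sigma + t] the key of a task. A schedule completing before time [K] has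
   to run every task with key at least [K] on the fast machine, and the fast
   machine of nev gives priority to large keys; hence, at a time [t] when the
   optimum of the tasks known so far is less than [K], the remaining fast work of
   the candidates with key at least [K] is at most [K - t].
     For [t = C] this shows that the tasks still waiting for the fast machine at
   time [C] have keys at most [C]. Let [i] be the one with the least key and [D]
   the time when the optimum first reaches that key. As [i] was not moved to a
   slow machine at time [D], [D > opt D / 2], so that the waiting tasks that
   arrived before [D] have remaining work at most [opt D - D]. The ones that
   arrived after [D] have keys greater than [3/2 * opt D]; the same reasoning with
   the least of their keys gives a time [D1 > opt D1 / 2 + D] and remaining work
   at most [opt D1 - D1]. A third generation would have keys greater than [C], so
   at most [opt D - 2 * D + opt D1 / 2 <= C / 2] remains at time [C], and the fast
   machine is done at time [3/2 * C]. *)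
Require Import Defs.
From mathcomp Require Import all_boot all_order all_algebra.
From mathcomp Require Import all_classical all_reals all_analysis.
From mathcomp Require Import lra.
Import Order.TTheory GRing.Theory Num.Theory.
Import numFieldNormedType.Exports.

Set Implicit Arguments.
Unset Strict Implicit.
Unset Printing Implicit Defensive.

Local Open Scope classical_set_scope.
Local Open Scope ring_scope.

(** * Lebesgue measure of a set inside a bounded interval *)

Section MeasureWithin.
Context {R : realType}.
Implicit Types (A B : set R) (a b c x p : R).

(** Boundedness of the interval makes the measure finite, hence real-valued; half-open intervals
    concatenate without overlap, and the value is 0 when [b <= a]. *)
Definition measure_within A a b : R := fine (lebesgue_measure (A `&` `[a, b[)).

Lemma lebesgue_measure_setI_itv A a b : measurable A ->
  lebesgue_measure (A `&` `[a, b[) = (measure_within A a b)%:E.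
Proof.
move=> mA; rewrite /measure_within fineK// ge0_fin_numE//.
apply: (@le_lt_trans _ _ (lebesgue_measure `[a, b[%classic)).
  by apply: le_measure; rewrite ?inE//; exact: measurableI.
by rewrite lebesgue_measure_itv /=; case: ifP => _; rewrite -?EFinB ltry.
Qed.

Lemma measure_within_ge0 A a b : 0 <= measure_within A a b.
Proof. exact: fine_ge0. Qed.

Lemma measure_within_le_len A a b : measurable A -> a <= b ->
  measure_within A a b <= b - a.
Proof.
move=> mA ab; rewrite -lee_fin -lebesgue_measure_setI_itv//.
apply: (@le_trans _ _ (lebesgue_measure `[a, b[%classic)).
  by apply: le_measure; rewrite ?inE//; exact: measurableI.
rewrite lebesgue_measure_itv /= lte_fin; case: ifP => _; first by rewrite EFinB.
by rewrite lee_fin subr_ge0.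
Qed.

Lemma measure_within_split A a b c : measurable A -> a <= b -> b <= c ->
  measure_within A a c = measure_within A a b + measure_within A b c.
Proof.
move=> mA ab bc; apply: EFin_inj; rewrite EFinD -!lebesgue_measure_setI_itv//.
rewrite -measureU//; try exact: measurableI; last first.
  apply/seteqP; split => x //= [[_]]; rewrite !in_itv /= => /andP[_ xb] [_ /andP[bx _]].
  by move: (lt_le_trans xb bx); rewrite ltxx.
congr lebesgue_measure; rewrite -setIUr; congr setI.
apply/seteqP; split => x /=; rewrite !in_itv /=.
  by move=> /andP[ax xc]; case: (ltP x b) => xb; [left|right]; rewrite ?ax ?xb ?xc.
by move=> [/andP[ax xb]|/andP[bx xc]]; rewrite ?ax ?xc ?(lt_le_trans xb bc)// (le_trans ab bx).
Qed.

Lemma measure_within_sub A B a b : measurable A -> measurable B ->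
  (forall s, a <= s -> s < b -> A s -> B s) ->
  measure_within A a b <= measure_within B a b.
Proof.
move=> mA mB AB; rewrite -lee_fin -!lebesgue_measure_setI_itv//.
apply: le_measure; rewrite ?inE//; try exact: measurableI.
move=> s /= [As]; rewrite in_itv /= => /andP[as_ sb]; split; last by rewrite as_ sb.
exact: AB.
Qed.

Lemma measure_within_eq0 A a b : measurable A ->
  (forall s, a <= s -> s < b -> ~ A s) -> measure_within A a b = 0.
Proof.
move=> mA AB; rewrite /measure_within (_ : A `&` _ = set0) ?measure0//.
apply/seteqP; split => s //= [As]; rewrite in_itv /= => /andP[as_ sb].
exact: (AB s).
Qed.

Lemma measure_within_empty A a b : b <= a -> measure_within A a b = 0.
Proof.
move=> ba; rewrite /measure_within (_ : A `&` _ = set0) ?measure0//.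
apply/seteqP; split => s //= [As]; rewrite in_itv /= => /andP[as_ sb].
by move: (lt_le_trans sb (le_trans ba as_)); rewrite ltxx.
Qed.

Lemma measure_within_full A a b : measurable A -> a <= b ->
  (forall s, a <= s -> s < b -> A s) -> measure_within A a b = b - a.
Proof.
move=> mA ab AB; apply: EFin_inj; rewrite -lebesgue_measure_setI_itv//.
rewrite (_ : A `&` _ = `[a, b[%classic); last first.
  apply/seteqP; split => s /=; first by case.
  move=> H; split => //; move: H; rewrite in_itv /= => /andP[as_ sb].
  exact: AB.
rewrite lebesgue_measure_itv /= lte_fin; case: ltP => [_|ba]; first by rewrite EFinB.
by rewrite (_ : a = b) ?subrr//; apply/eqP; rewrite eq_le ab ba.
Qed.

Lemma measure_within_le A a b c : measurable A -> b <= c ->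
  measure_within A a b <= measure_within A a c.
Proof.
move=> mA bc; case: (leP a b) => ab.
  by rewrite (measure_within_split mA ab bc) lerDl measure_within_ge0.
by rewrite measure_within_empty ?measure_within_ge0// ltW.
Qed.

Lemma measure_within_ext A B a b : (forall s, a <= s -> s < b -> A s <-> B s) ->
  measure_within A a b = measure_within B a b.
Proof.
move=> AB; rewrite /measure_within; congr (fine (lebesgue_measure _)).
by apply/seteqP; split => s /= [Xs]; rewrite in_itv /= => /andP[as_ sb];
  split; rewrite ?as_//; apply/AB.
Qed.

Lemma measure_within_shift A a b c : measurable A -> a <= b ->
  (forall s, s < b -> ~ A s) -> measure_within A a c = measure_within A b c.
Proof.
move=> mA ab Ab; have [bc|cb] := leP b c.
  by rewrite (measure_within_split mA ab bc) measure_within_eq0 ?add0r// => s _; exact: Ab.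
rewrite (measure_within_empty _ (ltW cb)) measure_within_eq0// => s _ sc.
exact/Ab/(lt_trans sc).
Qed.

Lemma measurable_has (r : seq nat) (P : pred nat) (A : nat -> set R) :
  (forall j, measurable (A j)) ->
  measurable [set s | exists2 j, (j \in r) && P j & A j s].
Proof.
move=> mA; elim: r => [|k r IH].
  by rewrite (_ : mkset _ = set0)//; apply/seteqP; split => s //= [[]].
have -> : [set s | exists2 j, (j \in k :: r) && P j & A j s] =
  (if P k then A k else set0) `|` [set s | exists2 j, (j \in r) && P j & A j s].
  apply/seteqP; split => s /=.
    move=> [j]; rewrite inE => /andP[/predU1P[->|jr] Pj] Aj.
      by left; rewrite Pj.
    by right; exists j; rewrite ?jr.
  move=> [|[j /andP[jr Pj] Aj]]; last by exists j; rewrite ?inE ?jr ?orbT.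
  by case: ifP => // Pk Ak; exists k; rewrite ?inE ?eqxx.
by apply: measurableU => //; case: ifP.
Qed.

(** Finite subadditivity, peeling off one set at a time; it bounds from below the total work of a
    busy machine. *)
Lemma measure_within_cover (r : seq nat) (P : pred nat) (A : nat -> set R) B a b :
  (forall j, measurable (A j)) -> measurable B ->
  (forall s, a <= s -> s < b -> B s -> exists2 j, (j \in r) && P j & A j s) ->
  measure_within B a b <= \sum_(j <- r | P j) measure_within (A j) a b.
Proof.
move=> mA; elim: r B => [|k r IH] B mB H.
  by rewrite big_nil measure_within_eq0// => s as_ sb /(H s as_ sb)[].
rewrite big_cons; set B' := B `\` A k.
have mB' : measurable B' by apply: measurableD.
have Bk : P k -> measure_within B a b <= measure_within (A k) a b + measure_within B' a b.
  move=> _; rewrite -lee_fin EFinD -!lebesgue_measure_setI_itv//.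
  apply: (le_trans _ (measureU2 _ _ _)); try by apply: measurableI => //; exact: mA.
  apply: le_measure; rewrite ?inE//; first exact: measurableI.
    by apply: measurableU; apply: measurableI => //; exact: mA.
  move=> s /= [Bs sab]; have [Aks|nAks] := pselect (A k s); [by left|right].
  by split.
case: ifP => Pk.
  apply: (le_trans (Bk Pk)); rewrite lerD2l; apply: IH => // s as_ sb [Bs nAk].
  have [j] := H s as_ sb Bs; rewrite inE => /andP[/predU1P[->//|jr] Pj] Aj.
  by exists j; rewrite ?jr.
apply: IH => // s as_ sb Bs.
have [j] := H s as_ sb Bs; rewrite inE => /andP[/predU1P[->|jr] Pj] Aj.
  by rewrite Pk in Pj.
by exists j; rewrite ?jr.
Qed.

(** Finite additivity over disjoint sets; it bounds from above the work that fits on one machine. *)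
Lemma measure_within_pack (r : seq nat) (P : pred nat) (A : nat -> set R) B a b :
  uniq r -> (forall j, measurable (A j)) -> measurable B ->
  (forall i j s, A i s -> A j s -> i = j) ->
  (forall j s, (j \in r) && P j -> a <= s -> s < b -> A j s -> B s) ->
  \sum_(j <- r | P j) measure_within (A j) a b <= measure_within B a b.
Proof.
move=> + mA + dA; elim: r B => [|k r IH] B /=.
  by rewrite big_nil => *; exact: measure_within_ge0.
move=> /andP[kr ur] mB AB; rewrite big_cons; case: ifP => Pk; last first.
  by apply: IH => // j s /andP[jr Pj]; apply: AB; rewrite inE jr orbT.
have mBk : measurable (B `\` A k) by apply: measurableD.
have IHB : \sum_(j <- r | P j) measure_within (A j) a b <= measure_within (B `\` A k) a b.
  apply: IH => // j s /andP[jr Pj] as_ sb Aj; split.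
    by apply: AB Aj; rewrite // inE jr orbT.
  by move=> Ak; move: kr; rewrite (dA _ _ _ Ak Aj) jr.
apply: (le_trans (y := measure_within (A k `|` (B `\` A k)) a b)); last first.
  apply: measure_within_sub => //; first exact: measurableU.
  by move=> s as_ sb [Ak|[]//]; apply: AB Ak; rewrite // inE eqxx.
rewrite (_ : measure_within (A k `|` _) a b =
  measure_within (A k) a b + measure_within (B `\` A k) a b) ?lerD2l//.
apply: EFin_inj; rewrite EFinD -!lebesgue_measure_setI_itv//; last exact: measurableU.
rewrite setIUl measureU//; try by apply: measurableI => //; exact: mA.
by apply/seteqP; split => s //= [[Ak _] [[]]].
Qed.

End MeasureWithin.

(** * First time at which a nondecreasing 1-Lipschitz function reaches a level *)

Section FirstHit.
Context {R : realType}.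

(** [z] is the supremum of the points where [f] is below [p]; the Lipschitz bound plays the part of
    continuity. *)
Lemma first_hit (f : R -> R) (a b p : R) :
  (forall x y, a <= x -> x <= y -> y <= b -> f x <= f y <= f x + (y - x)) ->
  a <= b -> f a < p -> p <= f b ->
  exists2 z, a <= z <= b & f z = p /\ forall s, a <= s -> s < z -> f s < p.
Proof.
move=> Hf ab fa fb; pose A := [set s | a <= s <= b /\ f s < p].
have Aa : A a by rewrite /A /= lexx ab.
have hA : has_sup A by split; [exists a | exists b => s [/andP[]]].
pose z := sup A.
have az : a <= z by apply: sup_upper_bound.
have zb : z <= b by apply: sup_le_ub => [|s [/andP[]]]; first by exists a.
have lt_z s : a <= s -> s < z -> f s < p.
  move=> as_ sz; have /(_ (z - s)) [] := @sup_adherent _ A; rewrite ?subr_gt0// -/z.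
  move=> s' [/andP[as' s'b] fs']; rewrite opprB addrC subrK => ss'.
  apply: le_lt_trans fs'; have /andP[] := Hf s s' as_ (ltW ss') s'b; lra.
exists z; first by rewrite az zb.
split => //; apply/eqP; rewrite eq_le; apply/andP; split.
  rewrite leNgt; apply/negP => pz.
  have az' : a < z by rewrite lt_neqAle az andbT; apply/eqP => E; move: pz; rewrite -E; lra.
  (* Going back from [z] by at most half the excess [f z - p] keeps [f] above [p], against
     [lt_z]. *)
  pose s := Num.max a (z - (f z - p) / 2).
  have sz : s < z by rewrite /s gt_max az' /=; lra.
  have as_ : a <= s by rewrite /s le_max lexx.
  have sz' : z - (f z - p) / 2 <= s by rewrite /s le_max lexx orbT.
  have := lt_z _ as_ sz; have /andP[] := Hf s z as_ (ltW sz) zb; lra.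
rewrite leNgt; apply/negP => pz.
have zb' : z < b by rewrite lt_neqAle zb andbT; apply/eqP => E; move: pz; rewrite E; lra.
pose s := Num.min b (z + (p - f z) / 2).
have sz : z < s by rewrite /s lt_min zb' /=; lra.
have sb : s <= b by rewrite /s ge_min lexx.
have sz' : s <= z + (p - f z) / 2 by rewrite /s ge_min lexx orbT.
have : s <= z.
  apply: sup_upper_bound => //; rewrite /A /= sb (le_trans az (ltW sz)); split => //.
  have /andP[] := Hf z s az (ltW sz) sb; lra.
by rewrite leNgt sz.
Qed.

End FirstHit.

(** * Truncations of a task arrival process *)

Section Truncation.
Context {R : realType}.
Implicit Types (T : seq (task R)) (s t : R) (i j : nat).

Lemma tap_runtimes T i : is_tap T -> (i < size T)%N ->
  [/\ 0 < slow_runtime (task_at T i), 0 < fast_runtime (task_at T i)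
    & 0 <= arrival (task_at T i)].
Proof. by move=> /andP[/all_nthP H _] iT; apply/and3P; exact: H. Qed.

Lemma tap_arrival_le T i j : is_tap T -> (i <= j)%N -> (j < size T)%N ->
  arrival (task_at T i) <= arrival (task_at T j).
Proof.
move=> /andP[_ sT] ij jT.
have tr : transitive (fun tau tau' : task R => arrival tau <= arrival tau').
  by move=> x y z; exact: le_trans.
have rf : reflexive (fun tau tau' : task R => arrival tau <= arrival tau').
  by move=> x; exact: lexx.
by apply: (sorted_leq_nth tr rf (Task 0 0 0) sT) => //; rewrite inE ?(leq_ltn_trans ij).
Qed.

Lemma truncation_take T t : is_tap T ->
  exists2 k, truncation T t = take k T &
    forall i, (i < size T)%N -> ((i < k)%N = (arrival (task_at T i) <= t)).
Proof.
move=> tT; pose n := find (fun tau : task R => t < arrival tau) T.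
have Hn i : (i < size T)%N -> ((i < n)%N = (arrival (task_at T i) <= t)).
  move=> iT; apply/idP/idP => [ilt|].
    by have := before_find (Task 0 0 0) ilt; rewrite -/(task_at T i) ltNge => /negbFE.
  apply: contraLR; rewrite -leqNgt -ltNge => ni.
  apply: (lt_le_trans _ (tap_arrival_le tT ni iT)).
  have hT : has (fun tau : task R => t < arrival tau) T by rewrite has_find (leq_ltn_trans ni).
  exact: (nth_find (Task 0 0 0) hT).
exists n => //.
rewrite /truncation -[in LHS](cat_take_drop n T) filter_cat.
rewrite (_ : [seq tau <- take n T | arrival tau <= t] = take n T); last first.
  apply/all_filterP/(all_nthP (Task 0 0 0)) => i; rewrite size_take_min leq_min => /andP[iltn iT].
  by rewrite nth_take// -/(task_at T i) -Hn.
rewrite (_ : [seq tau <- drop n T | arrival tau <= t] = [::]) ?cats0//.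
apply: size0nil; rewrite size_filter; apply/eqP; rewrite eqn0Ngt -has_count -all_predC.
apply/(all_nthP (Task 0 0 0)) => i /=.
rewrite size_drop ltn_subRL => iT; rewrite nth_drop.
by rewrite -/(task_at T (n + i)) -Hn// ltnNge leq_addr.
Qed.

Lemma size_truncation T t i : is_tap T ->
  (i < size (truncation T t))%N <-> arrived T i t.
Proof.
move=> tT; have [k -> Hk] := truncation_take t tT.
rewrite size_take_min leq_min /arrived; split=> [/andP[ik iT]|[iT it]].
  by rewrite -Hk.
by rewrite iT Hk// it.
Qed.

Lemma task_at_truncation T t i : is_tap T -> arrived T i t ->
  task_at (truncation T t) i = task_at T i.
Proof.
move=> tT [iT it]; have [k -> Hk] := truncation_take t tT.
by rewrite /task_at nth_take// Hk.
Qed.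

Lemma truncation_truncation T s t : s <= t ->
  truncation (truncation T t) s = truncation T s.
Proof.
move=> st; rewrite /truncation -filter_predI; apply: eq_filter => x /=.
by case: (leP (arrival x) s) => //= xs; rewrite (le_trans xs st).
Qed.

Lemma tap_truncation T t : is_tap T -> is_tap (truncation T t).
Proof.
move=> /andP[aT sT]; apply/andP; split.
  by rewrite /truncation all_filter; apply: sub_all aT => x /= ->; rewrite implybT.
apply: sorted_filter => // x y z; exact: le_trans.
Qed.

Lemma truncation_last T t : is_tap T ->
  (forall i, (i < size T)%N -> arrival (task_at T i) <= t) -> truncation T t = T.
Proof.
move=> tT H; apply/all_filterP/(all_nthP (Task 0 0 0)) => i iT; exact: H.
Qed.

(** The truncation is constant between arrivals, so a time can be replaced by the arrival of the
    last task known then, which is [l]. *)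
Lemma last_arrival T i s : is_tap T -> arrived T i s ->
  exists l, [/\ (l < size T)%N, arrival (task_at T i) <= arrival (task_at T l),
    arrival (task_at T l) <= s &
    truncation T s = truncation T (arrival (task_at T l))].
Proof.
move=> tT ai; have := ai; rewrite -size_truncation// => szi.
pose l := (size (truncation T s)).-1.
have /size_truncation [//|lT ls] : (l < size (truncation T s))%N by rewrite /l prednK// (leq_ltn_trans _ szi).
have il : (i <= l)%N by rewrite -ltnS prednK// (leq_ltn_trans _ szi).
exists l; split => //; first exact: tap_arrival_le.
rewrite -(truncation_truncation T ls) [RHS]truncation_last //; first by apply: tap_truncation.
move=> j jT; have aj := (size_truncation s j tT).1 jT; rewrite task_at_truncation//; have [jT' _] := aj.
by apply: tap_arrival_le => //; rewrite -ltnS prednK// (leq_ltn_trans _ szi).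
Qed.

End Truncation.

(** * The offline optimum and its monotonicity in time *)

Section Opt.
Context {R : realType}.
Implicit Types (T : seq (task R)) (S : schedule R) (s t c : R) (i j : nat).

Lemma completion_time_ge0 T S : (0 <= completion_time T S)%E.
Proof. by apply: le_ereal_inf_tmp => x [c [c0 _] <-]; rewrite lee_fin. Qed.

Lemma opt_ge0 T : (0 <= opt T)%E.
Proof. by apply: le_ereal_inf_tmp => x [S _ <-]; exact: completion_time_ge0. Qed.

Lemma work_by_within T S m i c : valid_schedule T S -> (i < size T)%N ->
  work_by S m i c =
    (measure_within [set s | S m s = Some i] (arrival (task_at T i)) c)%:E.
Proof.
move=> [arr _ _] iT; rewrite -lebesgue_measure_setI_itv; last exact: run_measurable.
congr lebesgue_measure; apply/seteqP; split => s /=; rewrite in_itv /=.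
  by move=> [sc Si]; split => //; have [_ ->] := arr _ _ _ Si.
by move=> [Si /andP[_ ?]].
Qed.

(** All work on [i] lies between its arrival and [c]; there is none if [c] precedes the arrival,
    while runtimes are positive. *)
Lemma arrival_runtime_le T S m i c : is_tap T -> valid_schedule T S ->
  (i < size T)%N -> ((runtime T m i)%:E <= work_by S m i c)%E ->
  arrival (task_at T i) + runtime T m i <= c.
Proof.
move=> tT vS iT; rewrite (work_by_within _ _ vS iT) lee_fin => H.
have rpos : 0 < runtime T m i by case: m {H} => [|k]; have [] := tap_runtimes tT iT.
have [ac|ca] := leP (arrival (task_at T i)) c.
  rewrite addrC -lerBrDr; apply: (le_trans H); apply: measure_within_le_len => //.
  exact: run_measurable.
by move: H; rewrite (measure_within_empty _ (ltW ca)) leNgt rpos.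
Qed.

Lemma opt_lt T (K : R) : (opt T < K%:E)%E ->
  exists S c, [/\ valid_schedule T S, 0 <= c, c < K & forall i, (i < size T)%N ->
    exists m, ((runtime T m i)%:E <= work_by S m i c)%E].
Proof.
move=> /ereal_inf_lt [_ [S vS <-]] /ereal_inf_lt [_ [c [c0 Hc] <-]].
by rewrite lte_fin => cK; exists S, c.
Qed.

Lemma arrival_le_opt T i : is_tap T -> (i < size T)%N ->
  ((arrival (task_at T i))%:E <= opt T)%E.
Proof.
move=> tT iT; rewrite leNgt; apply/negP => /opt_lt [S [c [vS c0 cK H]]].
have [m Hm] := H i iT; have := arrival_runtime_le tT vS iT Hm.
have rpos : 0 < runtime T m i by case: m {Hm} => [|k]; have [] := tap_runtimes tT iT.
lra.
Qed.

(** A schedule of [T], stripped of the tasks outside the truncation, is valid for the truncation and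
    completes no later. *)
Lemma opt_truncation_le T t : is_tap T -> (opt (truncation T t) <= opt T)%E.
Proof.
move=> tT; apply: le_ereal_inf_tmp => _ [S vS <-].
have arrS i : (i < size (truncation T t))%N -> arrived T i t by move/size_truncation; apply.
pose n := size (truncation T t).
pose r m s := if S m s is Some i then if (i < n)%N then Some i else None else None.
have rE m s i : r m s = Some i <-> (i < n)%N /\ S m s = Some i.
  rewrite /r; case: (S m s) => [j|]; last by split => // -[].
  case: ltnP => jn; split => //; first by case=> <-.
    by move=> [].
  by move=> [iltn [E]]; move: jn; rewrite E leqNgt iltn.
have rm m i : measurable [set s | r m s = Some i].
  have [iltn|ni] := ltnP i n.
    rewrite (_ : mkset _ = [set s | S m s = Some i]); first exact: run_measurable.
    by apply/seteqP; split => s /=; rewrite rE // => -[].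
  rewrite (_ : mkset _ = set0) ?measurable0//.
  by apply/seteqP; split => s //=; rewrite rE ltnNge ni => -[].
pose S' := Schedule rm.
have setE m i : (i < n)%N -> [set s | S' m s = Some i] = [set s | S m s = Some i].
  by move=> iltn; apply/seteqP; split => s /=; rewrite rE // => -[].
have rtE m i : (i < n)%N -> runtime (truncation T t) m i = runtime T m i.
  by move=> iltn; case: m => [|k] /=; rewrite task_at_truncation//; exact: arrS.
have [v1 v2 v3] := vS.
apply: (@le_trans _ _ (completion_time (truncation T t) S')).
  apply: ereal_inf_lbound; exists S' => //; split.
  - move=> m i s /rE[iltn /v1 [_ is_]]; split=> //.
    by rewrite task_at_truncation//; exact: arrS.
  - by move=> m m' i s s' /rE[_ Si] /rE[_ Si']; exact: v2 Si Si'.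
  - move=> i iltn; have [iT _] := arrS _ iltn; have [m Hm] := v3 i iT.
    by exists m; rewrite /total_work setE// rtE.
apply: le_ereal_inf_tmp => _ [c [c0 Hc] <-]; apply: ereal_inf_lbound; exists c => //; split => // i iltn.
have [iT _] := arrS _ iltn; have [m Hm] := Hc i iT; exists m; rewrite rtE//.
rewrite /work_by (_ : [set s | s < c /\ S' m s = Some i] = [set s | s < c /\ S m s = Some i])//.
by apply/seteqP; split => s /= -[sc]; rewrite rE // => -[].
Qed.

Lemma opt_truncation_mono T s t : is_tap T -> s <= t ->
  (opt (truncation T s) <= opt (truncation T t))%E.
Proof.
by move=> tT st; rewrite -(truncation_truncation T st); apply/opt_truncation_le/tap_truncation.
Qed.

End Opt.

(** * The priority order of the fast machine *)

Section Priority.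
Context {R : realType}.
Variable T : seq (task R).
Implicit Types (s t : R) (i j k : nat).

Definition key i : R := slow_runtime (task_at T i) + arrival (task_at T i).

(** The strict order behind [fast_choice], tie-breaking included. *)
Definition prio j i := (key i < key j) || ((key i == key j) && (j < i)%N).

Lemma prio_irr i : prio i i = false.
Proof. by rewrite /prio ltxx ltnn andbF. Qed.

Lemma prio_trans k j i : prio k j -> prio j i -> prio k i.
Proof.
rewrite /prio => /orP[kj|/andP[/eqP kj ltkj]] /orP[ji|/andP[/eqP ji ltji]].
- by rewrite (lt_trans ji kj).
- by rewrite ji kj.
- by rewrite -kj ji.
- by rewrite ji kj eqxx (ltn_trans ltkj ltji) orbT.
Qed.

Lemma prio_total i j : [\/ i = j, prio i j | prio j i].
Proof.
rewrite /prio eq_sym; case: (ltgtP (key i) (key j)) => ij.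
- by constructor 3.
- by constructor 2.
- case: (ltngtP i j) => ij'; [constructor 2|constructor 3|constructor 1]; by rewrite // ij' orbT.
Qed.

Lemma prio_key j i : prio j i -> key i <= key j.
Proof. by move=> /orP[/ltW//|/andP[/eqP -> _]]. Qed.

(** The measure for all inductions along the priority order. *)
Definition rank i := count (prio^~ i) (iota 0 (size T)).

Lemma rank_lt j i : (j < size T)%N -> prio j i -> (rank j < rank i)%N.
Proof.
move=> jT ji; rewrite /rank.
have: forall r : seq nat, (count (prio^~ j) r + count (pred1 j) r <= count (prio^~ i) r)%N.
  elim=> //= k r IH; rewrite addnACA; apply: leq_add => //.
  case: eqP => [->|_]; first by rewrite prio_irr ji.
  by rewrite addn0; case kj: (prio k j) => //; rewrite (prio_trans kj ji).
move=> /(_ (iota 0 (size T))); apply: leq_trans.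
by rewrite -addn1 leq_add2l -has_count has_pred1 mem_iota.
Qed.


End Priority.

(** * Earliest times of properties that begin at arrivals *)

Section FirstArrival.
Context {R : realType}.
Variable T : seq (task R).
Hypothesis tT : is_tap T.

(** A property that can always be traced back to an arrival has an earliest time, because there are
    finitely many arrivals. *)
Lemma first_arrival (P : R -> Prop) :
  (forall s, P s -> exists l, [/\ (l < size T)%N, arrival (task_at T l) <= s
    & P (arrival (task_at T l))]) ->
  (exists s, P s) ->
  exists l, [/\ (l < size T)%N, P (arrival (task_at T l))
    & forall s, P s -> arrival (task_at T l) <= s].
Proof.
move=> HP [s0 Ps0]; have [l0 [l0T _ Pl0]] := HP _ Ps0.
pose p l := (l < size T)%N && `[< P (arrival (task_at T l)) >].
have exp : exists l, p l by exists l0; rewrite /p l0T; apply/asboolP.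
case: (ex_minnP exp) => l /andP[lT /asboolP Pl] lmin; exists l; split => // s Ps.
have [l' [l'T l's Pl']] := HP _ Ps; apply: le_trans l's; apply: tap_arrival_le => //.
by apply: lmin; rewrite /p l'T; apply/asboolP.
Qed.

(** The part of [slow_safe] that does not depend on the execution. *)
Definition opt_safe i t : Prop := arrived T i t /\
  ((slow_runtime (task_at T i) + t)%:E <= (3 / 2)%:E * opt (truncation T t))%E.

(** Moving back to the last arrival leaves the optimum unchanged and only lowers
    [slow_runtime + t]. *)
Lemma opt_safe_first i s : opt_safe i s ->
  exists a, [/\ opt_safe i a, a <= s & forall s', opt_safe i s' -> a <= s'].
Proof.
move=> Ps; have [|l [lT Pl lmin]] := @first_arrival (opt_safe i) _ (ex_intro _ s Ps).
  move=> s' [ai Hs']; have [l [lT il ls' E]] := last_arrival tT ai.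
  exists l; split => //; split; first by case: ai.
  rewrite -E; apply: le_trans Hs'; rewrite lee_fin; lra.
by exists (arrival (task_at T l)); split => //; exact: lmin.
Qed.

End FirstArrival.

(** * Fast work and completion in an arbitrary execution *)

Section Executions.
Context {R : realType}.
Variables (T : seq (task R)) (E : execution R).
Hypothesis tT : is_tap T.
Implicit Types (s t a b c : R) (i j k : nat).

Definition fast_set i : set R := [set s | E Fast s = Some i].

Definition fast_work i t : R := measure_within (fast_set i) 0 t.

Lemma measurable_fast_set i : measurable (fast_set i).
Proof. exact: run_measurable. Qed.

Lemma fast_work_mono i s t : s <= t -> fast_work i s <= fast_work i t.
Proof. by apply: measure_within_le; exact: measurable_fast_set. Qed.

Lemma starts_slow_inj i a b : starts_slow T E i a -> starts_slow T E i b -> a = b.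
Proof.
move=> [sa ma] [sb mb]; case: (ltgtP a b) => // ab.
  by have := mb _ ab.
by have := ma _ ab.
Qed.

Lemma completed_uncancelled i t : (i < size T)%N ->
  (forall c, Defs.cancel E i c -> t <= c) ->
  (forall s, E Fast s = Some i -> 0 <= s) ->
  (forall k s, s < t -> E (Slow k) s <> Some i) ->
  completed T E i t <-> fast_runtime (task_at T i) <= fast_work i t.
Proof.
move=> iT Hc Hf Hs; have [s0 p0 a0] := tap_runtimes tT iT.
have PF : progress E Fast i t = (fast_work i t)%:E.
  rewrite -lebesgue_measure_setI_itv; last exact: measurable_fast_set.
  congr lebesgue_measure; apply/seteqP; split => s /=; rewrite in_itv /=.
    by move=> [st Es _]; split => //; rewrite st andbT; exact: Hf.
  move=> [Es /andP[_ st]]; split => // c /Hc tc.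
  by move=> /(le_lt_trans tc); rewrite ltxx.
split=> [[[|k]]|H]; last by exists Fast; rewrite PF lee_fin.
  by rewrite PF lee_fin.
rewrite /progress (_ : mkset _ = set0); last first.
  by apply/seteqP; split => s //= [st Es _]; exact: Hs st Es.
by rewrite measure0 lee_fin leNgt s0.
Qed.

(** The cancellation at [a] erases all earlier work, so only the slow run from [a] on counts. The
    inequality [a < t] is strict because [progress] takes into account only cancellations strictly
    before [t]. *)
Lemma completed_cancelled i a t : (i < size T)%N -> a < t ->
  (forall c, Defs.cancel E i c <-> c = a) ->
  (forall s, a <= s -> E Fast s <> Some i) ->
  (forall k s, E (Slow k) s = Some i -> k = i) ->
  completed T E i t <-> slow_runtime (task_at T i) <=
    measure_within [set s | E (Slow i) s = Some i] a t.
Proof.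
move=> iT at_ Hc Hf Hs; have [s0 p0 a0] := tap_runtimes tT iT.
have PS : progress E (Slow i) i t =
    (measure_within [set s | E (Slow i) s = Some i] a t)%:E.
  rewrite -lebesgue_measure_setI_itv; last exact: run_measurable.
  congr lebesgue_measure; apply/seteqP; split => x /=; rewrite in_itv /=.
    by move=> [xs Ex Hx]; split => //; rewrite xs andbT; apply: Hx at_; apply/Hc.
  by move=> [Ex /andP[ax xs]]; split => // c /Hc ->.
split=> [[m]|H]; last by exists (Slow i); rewrite PS lee_fin.
have [->|mi] := pselect (m = Slow i); first by rewrite PS lee_fin.
rewrite /progress (_ : mkset _ = set0).
  by rewrite measure0 lee_fin leNgt; case: m mi => [|k] _ /=; rewrite ?s0 ?p0.
apply/seteqP; split => x //= [xs Ex Hx].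
have ax : a <= x by apply: Hx at_; apply/Hc.
by case: m mi Ex => [_ /Hf|k ki /Hs ki']; [exact|apply: ki; rewrite ki'].
Qed.

Lemma fast_choiceE i s : fast_choice T E i s <->
  fast_candidate T E i s /\ forall j, prio T j i -> ~ fast_candidate T E j s.
Proof.
split=> [[ci ch]|[ci ch]]; split => // j.
  move=> ji /ch /= []; first by move/prio_key: ji; rewrite /key ltNge => ->.
  move: ji => /orP[|/andP[_ ji] [_]]; last by rewrite leqNgt ji.
  by rewrite /key => + [E' _]; rewrite -E' ltxx.
move=> cj /=; have [<-|ij|/ch//] := prio_total T i j; first by right.
move: ij => /orP[|/andP[/eqP ? /ltnW ?]]; first by left.
by right.
Qed.

End Executions.

(** * A recursive equation for the candidates *)

Section CandidateRule.
Context {R : realType}.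
Variable T : seq (task R).
Implicit Types (cand : nat -> R -> Prop) (i j : nat) (s t : R).

Definition unpreempted cand i : set R :=
  [set s | forall j, prio T j i -> ~ cand j s].

(* The candidates of a nev execution satisfy [cand i t <-> cand_rule cand i t],
   where the right-hand side only involves the candidates of higher priority:
   this equation has a unique solution. *)
Definition cand_rule cand i t : Prop :=
  [/\ arrived T i t,
      measure_within (unpreempted cand i) (arrival (task_at T i)) t
        < fast_runtime (task_at T i)
    & forall s, s <= t -> ~ opt_safe T i s].

(** The times at which a given task is a candidate form an interval, and finitely many such
    intervals are removed. *)
Lemma measurable_unpreempted cand i :
  (forall j t, cand j t -> arrived T j t) ->
  (forall j s t, cand j t -> arrival (task_at T j) <= s -> s <= t -> cand j s) ->
  measurable (unpreempted cand i).
Proof.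
move=> Harr Hle; rewrite (_ : unpreempted cand i =
    ~` [set s | exists2 j, (j \in iota 0 (size T)) && prio T j i & cand j s]).
  apply: measurableC; apply: (measurable_has _ _ (A := fun j => [set s | cand j s])) => j.
  apply: measurable_realfun.is_interval_measurable => x y /= cx cy z /andP[xz zy].
  by apply: Hle cy _ zy; apply: le_trans xz; have [] := Harr _ _ cx.
apply/seteqP; split => s /= H; first by move=> [j /andP[_ ji] cj]; exact: H cj.
move=> j ji cj; apply: H; exists j => //; rewrite ji andbT mem_iota /=.
by have [] := Harr _ _ cj.
Qed.

End CandidateRule.

(** * Explicit description of a nev execution *)

Section NevFacts.
Context {R : realType}.
Variables (T : seq (task R)) (E : execution R).
Hypotheses (tT : is_tap T) (nevE : nev_execution T E).
Implicit Types (s t a b c : R) (i j k : nat).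

Local Notation sigma i := (slow_runtime (task_at T i)).
Local Notation pie i := (fast_runtime (task_at T i)).
Local Notation arr i := (arrival (task_at T i)).
Local Notation cand := (fast_candidate T E).

Local Notation fast_set := (fast_set E).
Local Notation fast_work := (fast_work E).
Hint Resolve measurable_fast_set : core.

Lemma cancelE i c : Defs.cancel E i c <-> starts_slow T E i c.
Proof. by have [] := nevE c i. Qed.

Lemma slow_runE k i t : E (Slow k) t = Some i <-> k = i /\ running_slow T E i t.
Proof. by have [_ H _] := nevE t i. Qed.

Lemma fast_run_cand i s : E Fast s = Some i -> cand i s.
Proof. by have [_ _ H] := nevE s i; move/H => []. Qed.

Lemma starts_slow_opt_safe i a : starts_slow T E i a -> opt_safe T i a.
Proof. by move=> [[[]]]. Qed.

Lemma fast_set_arr i s : s < arr i -> ~ fast_set i s.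
Proof.
by move=> si /fast_run_cand[[[_ +] _] _]; rewrite leNgt si.
Qed.

Lemma completed_nostart i t : (i < size T)%N ->
  (forall c, starts_slow T E i c -> t <= c) ->
  completed T E i t <-> pie i <= fast_work i t.
Proof.
move=> iT Hc; have [_ _ a0] := tap_runtimes tT iT; apply: completed_uncancelled => //.
- by move=> c /cancelE /Hc.
- by move=> s Es; apply: (le_trans a0); rewrite leNgt; apply/negP => /fast_set_arr.
- move=> k s st /slow_runE [_ [_ [c cs /Hc tc]]].
  by move: (lt_le_trans st (le_trans tc cs)); rewrite ltxx.
Qed.

(** A task completed at [a] has its full fast work, as no slow start precedes [a]. Fast work never
    decreases, so the task would still be completed at any later slow start; hence none occurs and
    it stays completed. *)
Lemma pending_first_safe i a s : opt_safe T i a ->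
  (forall s', opt_safe T i s' -> a <= s') -> a <= s -> pending T E i s ->
  pending T E i a.
Proof.
move=> Pa amin as_ [[iT ai] ns]; split; first by case: Pa.
have nostart c : starts_slow T E i c -> a <= c by move/starts_slow_opt_safe/amin.
move=> /(completed_nostart iT nostart) pa; apply: ns.
apply/completed_nostart => // [c Sc|]; last exact: le_trans pa (fast_work_mono E _ as_).
exfalso; have [[[_ +] _] _] := Sc; apply; apply/completed_nostart => //.
  by move=> c' /(starts_slow_inj Sc) ->.
exact: le_trans pa (fast_work_mono E _ (nostart _ Sc)).
Qed.

(** This removes the circularity between starts, cancellations and completion: only the first
    [opt_safe] time and the fast work done by then matter. *)
Lemma starts_slowE i a : starts_slow T E i a <->
  [/\ opt_safe T i a, forall s, s < a -> ~ opt_safe T i s & fast_work i a < pie i].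
Proof.
split=> [Sa|[Pa amin wa]].
  have Pa := starts_slow_opt_safe Sa; have [iT _] := Pa.1; split => //.
    move=> s sa Ps; have [b [Pb bs bmin]] := opt_safe_first tT Ps.
    have ba := le_lt_trans bs sa; have [[pa _] H] := Sa; apply: (H b ba).
    split; [exact: pending_first_safe Pb bmin (ltW ba) pa|by case: Pb].
  rewrite ltNge; apply/negP => H; have [[[_ +] _] _] := Sa; apply.
  by apply/completed_nostart => // c /(starts_slow_inj Sa) ->.
have [iT _] := Pa.1.
have nostart c : starts_slow T E i c -> a <= c.
  by move=> /starts_slow_opt_safe Pc; rewrite leNgt; apply/negP => /amin.
split; first split; [split| |]; try by case: Pa.
  by move/(completed_nostart iT nostart); rewrite leNgt wa.
by move=> s sa [[as_ _] Hs]; apply: (amin s sa).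
Qed.

(** A task ceases to be a candidate when its fast work is done or when its first [opt_safe] time
    comes; if still pending at that time, it starts on a slow machine. *)
Lemma candE i t : cand i t <->
  [/\ arrived T i t, fast_work i t < pie i & forall s, s <= t -> ~ opt_safe T i s].
Proof.
split=> [[pt nr]|[ait wt nP]].
  have nostart c : starts_slow T E i c -> t < c.
    by move=> Sc; rewrite ltNge; apply/negP => ct; apply: nr; split => //; exists c.
  have [ait nc] := pt; have [iT _] := ait; split => //.
    rewrite ltNge; apply/negP => H; apply: nc; apply/completed_nostart => //.
    by move=> c /nostart/ltW.
  move=> s st Ps; have [b [Pb bs bmin]] := opt_safe_first tT Ps.
  have bt := le_trans bs st; have pb := pending_first_safe Pb bmin bt pt.
  suff /nostart : starts_slow T E i b by rewrite ltNge bt.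
  split; first by split => //; case: Pb.
  by move=> s' s'b [[as' _] Hs']; have := bmin s' (conj as' Hs'); rewrite leNgt s'b.
have nostart c : starts_slow T E i c -> t < c.
  by move=> /starts_slow_opt_safe Pc; rewrite ltNge; apply/negP => /nP.
have [iT _] := ait; split.
  split => // /(completed_nostart iT) H.
  by move: wt; rewrite ltNge H// => c /nostart/ltW.
by move=> [_ [c ct /nostart]]; rewrite ltNge ct.
Qed.

Lemma cand_le i s t : cand i t -> arr i <= s -> s <= t -> cand i s.
Proof.
move=> /candE [[iT _] wt nP] is_ st; apply/candE; split => //.
  exact: le_lt_trans (fast_work_mono E _ st) wt.
by move=> s' s's; apply: nP; exact: le_trans st.
Qed.

Lemma cand_or i t : arrived T i t ->
  [\/ cand i t, pie i <= fast_work i t | exists2 a, a <= t & starts_slow T E i a].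
Proof.
move=> ait; have [w|w] := leP (pie i) (fast_work i t); first by constructor 2.
have [[s [st Ps]]|nP] := pselect (exists s, s <= t /\ opt_safe T i s); last first.
  by constructor 1; apply/candE; split => // s st Ps; apply: nP; exists s.
constructor 3; have [b [Pb bs bmin]] := opt_safe_first tT Ps.
exists b; first exact: le_trans st.
apply/starts_slowE; split => //.
  by move=> s' s'b /bmin; rewrite leNgt s'b.
exact: le_lt_trans (fast_work_mono E _ (le_trans bs st)) w.
Qed.

Lemma fast_runE i s : E Fast s = Some i <->
  cand i s /\ forall j, prio T j i -> ~ cand j s.
Proof. by have [_ _ ->] := nevE s i; exact: fast_choiceE. Qed.

(** Induction on the rank: either [i] is the first candidate or one of higher priority takes its
    place. *)
Lemma fast_busy i s : cand i s -> exists2 j, E Fast s = Some j & j = i \/ prio T j i.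
Proof.
move: {2}(rank T i).+1 (ltnSn (rank T i)) => n; elim: n i => // n IH i rn ci.
have [[j [ji cj]]|nj] := pselect (exists j, prio T j i /\ cand j s); last first.
  by exists i; [apply/fast_runE; split => // j ji cj; apply: nj; exists j|left].
have [[[jT _] _] _] := cj.
have [|k Ek kj] := IH j _ cj; first exact: leq_trans (rank_lt jT ji) _.
by exists k => //; right; case: kj => [->//|kj]; exact: prio_trans ji.
Qed.

Lemma fast_work_le i t : (i < size T)%N -> fast_work i t <= pie i.
Proof.
move=> iT; have [s0 p0 a0] := tap_runtimes tT iT.
rewrite leNgt; apply/negP => Ht.
have t0 : 0 <= t.
  rewrite leNgt; apply/negP => t0; move: Ht.
  by rewrite /fast_work measure_within_empty ?(ltW t0)// ltNge (ltW p0).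
(* From the first time [z] at which the fast work reaches [pie i], the task is no longer a candidate
   and gains no more work. *)
have [|||z /andP[z0 zt] [Hz _]] := @first_hit R (fast_work i) 0 t (pie i) _ t0.
- move=> x y x0 xy yt; rewrite fast_work_mono//= /fast_work (measure_within_split _ x0 xy)//.
  by rewrite lerD2l measure_within_le_len.
- by rewrite /fast_work measure_within_empty.
- exact: ltW.
move: Ht; rewrite /fast_work (measure_within_split _ z0 zt)// -/(fast_work i z) Hz.
rewrite measure_within_eq0 ?addr0 ?ltxx// => s zs st /fast_run_cand /candE[_ + _].
by rewrite ltNge -Hz fast_work_mono.
Qed.

Lemma fast_work_from i t a : 0 <= a -> a <= arr i ->
  fast_work i t = measure_within (fast_set i) a t.
Proof.
move=> a0 ai; apply: measure_within_shift => // s sa.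
by apply: fast_set_arr; exact: lt_le_trans ai.
Qed.

(** As long as [i] is a candidate it runs exactly at its unpreempted times, and every fast run of
    [i] is at such a time; each fact gives one direction. *)
Lemma cand_rec i t : cand i t <-> cand_rule T cand i t.
Proof.
have mU : measurable (unpreempted T cand i).
  apply: measurable_unpreempted => [j s [[]]//|j s s' cj].
  exact: cand_le cj.
split=> [ci|[ait mt nP]].
  have /candE [ait wt nP] := ci; split => //; apply: le_lt_trans wt.
  have [iT _] := ait; have [_ _ a0] := tap_runtimes tT iT.
  rewrite (fast_work_from _ a0)//; apply: measure_within_sub => // s as_ st Us.
  by apply/fast_runE; split => //; apply: cand_le ci as_ (ltW st).
apply/candE; split => //; apply: le_lt_trans mt.
have [iT _] := ait; have [_ _ a0] := tap_runtimes tT iT.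
rewrite (fast_work_from _ a0)//; apply: measure_within_sub => // s as_ st.
by move/fast_runE => [].
Qed.

(** Before [a + sigma i] too little time has passed for completion, so the run is uninterrupted; it
    therefore accumulates [sigma i] by then and ends. *)
Lemma running_slowE i a t : starts_slow T E i a ->
  running_slow T E i t <-> a <= t < a + sigma i.
Proof.
move=> Sa; have [[iT ia] _] := starts_slow_opt_safe Sa.
have [s0 p0 a0] := tap_runtimes tT iT.
have runE (s : R) : running_slow T E i s <-> pending T E i s /\ a <= s.
  split=> [[ps [c cs /(starts_slow_inj Sa) ->]]|[ps as_]]; first by [].
  by split => //; exists a.
pose X : set R := [set s | E (Slow i) s = Some i].
have mX : measurable X by exact: run_measurable.
have XE s : X s <-> running_slow T E i s.
  by rewrite /X /= slow_runE; split=> [[]|].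
have complE (s : R) : a < s -> completed T E i s <-> sigma i <= measure_within X a s.
  move=> as_; apply: completed_cancelled => //.
  - move=> c; rewrite cancelE; split=> [Sc|-> //]; exact: starts_slow_inj Sc Sa.
  - by move=> x ax /fast_run_cand[px]; apply; apply/runE.
  - by move=> k x /slow_runE[].
have pend (s : R) : a <= s -> s < a + sigma i -> pending T E i s.
  rewrite le_eqVlt => /predU1P[<- _|as_ sa]; first by case: Sa => -[].
  split; first by split => //; exact: le_trans (ltW as_).
  move/(complE s as_); rewrite leNgt => /negP; apply.
  by apply: le_lt_trans (measure_within_le_len mX (ltW as_)) _; rewrite ltrBlDl.
split=> [/runE[pt at_]|/andP[at_ ta]]; last by apply/runE; split => //; exact: pend.
rewrite at_ ltNge; apply/negP => sat; case: pt => _; apply.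
apply/complE; first by apply: lt_le_trans sat; rewrite ltrDl.
apply: le_trans (measure_within_le a mX sat).
rewrite measure_within_full ?lerDl ?(ltW s0)//; first by rewrite addrC addKr.
by move=> s as_ sa; apply/XE/runE; split => //; exact: pend.
Qed.

Lemma surviving_runE m i s : surviving E m s = Some i <->
  E m s = Some i /\ forall c, starts_slow T E i c -> c <= s.
Proof.
rewrite /= /surviving_run; case: (E m s) => [j|]; last by split => // -[].
case: asboolP => H; split => //.
- by case=> <-; split => // c /cancelE; exact: H.
- by case.
- by move=> [[<-]] H'; case: H => c /cancelE /H'.
Qed.

End NevFacts.

(** * Validity of nev executions *)

Section NevValid.
Context {R : realType}.
Variables (T : seq (task R)) (E : execution R).
Hypotheses (tT : is_tap T) (nevE : nev_execution T E).
Implicit Types (s t a b c : R) (i j k : nat).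

Local Notation sigma i := (slow_runtime (task_at T i)).
Local Notation pie i := (fast_runtime (task_at T i)).
Local Notation arr i := (arrival (task_at T i)).
Local Notation cand := (fast_candidate T E).
Local Notation mfast := (measurable_fast_set E).

Lemma fast_work_busy a b (P : pred nat) : 0 <= a -> a <= b ->
  (forall s, a <= s -> s < b -> exists2 j, P j & E Fast s = Some j) ->
  b - a <= \sum_(j <- iota 0 (size T) | P j) measure_within (fast_set E j) a b.
Proof.
move=> a0 ab H; rewrite -(@measure_within_full R setT a b)//.
apply: measure_within_cover => // [j|s as_ sb _]; first exact: mfast.
have [j Pj Ej] := H s as_ sb; exists j => //; rewrite Pj andbT mem_iota /=.
by have [[[]]] := fast_run_cand nevE Ej.
Qed.

Lemma measure_within_fast_le_work i a b : 0 <= a -> a <= b ->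
  measure_within (fast_set E i) a b <= fast_work E i b.
Proof.
move=> a0 ab; rewrite /fast_work (measure_within_split (mfast i) a0 ab).
by rewrite lerDr measure_within_ge0.
Qed.

Lemma fast_work_complete i : (i < size T)%N -> ~ (exists a, starts_slow T E i a) ->
  exists t, fast_work E i t = pie i.
Proof.
move=> iT ns; have [s0 p0 a0] := tap_runtimes tT iT.
pose W := \sum_(j <- iota 0 (size T)) pie j.
have W0 : 0 <= W.
  rewrite /W big_seq_cond; apply: sumr_ge0 => j; rewrite mem_iota andbT => jT.
  by have [_ /ltW] := tap_runtimes tT jT.
(* If [i] were unfinished at this time, the fast machine would have been busy for [W + 1], although
   all fast work amounts to [W]. *)
exists (arr i + W + 1); apply/eqP; rewrite eq_le fast_work_le//= leNgt; apply/negP => wlt.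
have candb s : arr i <= s -> s < arr i + W + 1 -> cand i s.
  move=> as_ sb; have [//|le|[a _ Sa]] := cand_or tT nevE (conj iT as_).
    by move: wlt; rewrite ltNge (le_trans le)// fast_work_mono// ltW.
  by case: ns; exists a.
have : arr i + W + 1 - arr i <= \sum_(j <- iota 0 (size T) | predT j)
    measure_within (fast_set E j) (arr i) (arr i + W + 1).
  apply: fast_work_busy => //; first by lra.
  move=> s as_ sb; have [j Ej _] := fast_busy nevE (candb s as_ sb).
  by exists j.
apply/negP; rewrite -ltNge; apply: (@le_lt_trans _ _ W); last by lra.
rewrite /W big_seq_cond [leRHS]big_seq_cond; apply: ler_sum => j.
rewrite mem_iota andbT => jT.
apply: le_trans (fast_work_le tT nevE (arr i + W + 1) jT).
by apply: measure_within_fast_le_work => //; rewrite -/W; lra.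
Qed.

Lemma nev_total_work i : (i < size T)%N ->
  exists m, total_work (surviving E) m i = (runtime T m i)%:E.
Proof.
move=> iT; have [s0 p0 a0] := tap_runtimes tT iT.
have [[a Sa]|ns] := pselect (exists a, starts_slow T E i a).
  exists (Slow i); rewrite /total_work (_ : mkset _ = `[a, a + sigma i[%classic).
    by rewrite lebesgue_measure_itv /= lte_fin ltrDl s0 -EFinB addrC addKr.
  apply/seteqP; split => s /=; rewrite in_itv /=.
    by move/(surviving_runE nevE) => [/(slow_runE nevE)[_ /(running_slowE tT nevE _ Sa)]].
  move=> H; apply/(surviving_runE nevE); split.
    by apply/(slow_runE nevE); split => //; apply/(running_slowE tT nevE _ Sa).
  by move=> c /(starts_slow_inj Sa) <-; case/andP: H.
exists Fast; have [t wt] := fast_work_complete iT ns.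
rewrite /total_work /= -wt /fast_work -lebesgue_measure_setI_itv; last exact: mfast.
congr lebesgue_measure; apply/seteqP; split => s /=; last first.
  move=> [Es _]; apply/(surviving_runE nevE); split => // c Sc.
  by case: ns; exists c.
move=> /(surviving_runE nevE)[Es _]; split => //; rewrite in_itv /=.
have /(candE tT nevE) [[_ as_] ws _] := fast_run_cand nevE Es.
rewrite (le_trans a0 as_) ltNge /=; apply/negP => ts.
by move: ws; rewrite -wt ltNge fast_work_mono.
Qed.

Lemma nev_run_arrived m i t : E m t = Some i -> arrived T i t.
Proof.
case: m => [/(fast_run_cand nevE)[[]]//|k /(slow_runE nevE)[_ [[]]]//].
Qed.

(** The only possible move is from the fast machine to the slow machine of the task, and it crosses
    the slow start. *)
Lemma nev_migration m m' i t t' : t <= t' -> E m t = Some i -> E m' t' = Some i ->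
  m <> m' -> exists c, [/\ t < c, c <= t' & starts_slow T E i c].
Proof.
move=> tt'; case: m => [|k]; case: m' => [|k'] //.
- move=> /(fast_run_cand nevE)[pt nr] /(slow_runE nevE)[_ [_ [c ct' Sc]]] _.
  exists c; split => //; rewrite ltNge; apply/negP => ct; apply: nr; split => //.
  by exists c.
- move=> /(slow_runE nevE)[_ [_ [c ct Sc]]] /(fast_run_cand nevE)[pt' nr] _.
  by case: nr; split => //; exists c => //; exact: le_trans tt'.
- by move=> /(slow_runE nevE)[-> _] /(slow_runE nevE)[-> _].
Qed.

Lemma nev_valid : valid_execution T E.
Proof.
split; first exact: nev_run_arrived.
  move=> m m' i t t' tt' Et Et' mm'; have [c [? ? ?]] := nev_migration tt' Et Et' mm'.
  by exists c; split => //; apply/(cancelE nevE).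
split; last exact: nev_total_work.
  by move=> m i t /(surviving_runE nevE)[/nev_run_arrived].
(* A surviving run comes after every cancellation of its task, so no migration can follow it. *)
have aux m m' i t t' : t <= t' -> surviving E m t = Some i ->
    surviving E m' t' = Some i -> m = m'.
  move=> tt' /(surviving_runE nevE)[Et Ht] /(surviving_runE nevE)[Et' _].
  apply: contrapT => /(nev_migration tt' Et Et')[c [tc _ /Ht]].
  by rewrite leNgt tc.
move=> m m' i t t' Et Et'; case: (leP t t') => tt'; first exact: aux tt' Et Et'.
exact/esym/(aux _ _ _ _ _ (ltW tt') Et' Et).
Qed.

End NevValid.

(** * The online property *)

Section NevOnline.
Context {R : realType}.
Implicit Types (T : seq (task R)) (E : execution R) (s t : R) (i j : nat).

Lemma arrived_eq T T' t i s : is_tap T -> is_tap T' ->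
  truncation T t = truncation T' t -> s <= t -> arrived T i s ->
  arrived T' i s /\ task_at T i = task_at T' i.
Proof.
move=> tT tT' TT' st [iT is_]; have ait : arrived T i t by split => //; exact: le_trans st.
have ait' : arrived T' i t by apply/size_truncation => //; rewrite -TT'; apply/size_truncation.
have e : task_at T i = task_at T' i.
  by rewrite -(task_at_truncation tT ait) TT' task_at_truncation.
by split => //; split; [case: ait'|rewrite -e].
Qed.

Lemma opt_safe_eq T T' t i s : is_tap T -> is_tap T' ->
  truncation T t = truncation T' t -> s <= t -> opt_safe T i s -> opt_safe T' i s.
Proof.
move=> tT tT' TT' st [ais H]; have [ais' ei] := arrived_eq tT tT' TT' st ais.
by split => //; rewrite -ei; move: H; rewrite -(truncation_truncation T st) TT' truncation_truncation.
Qed.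

Lemma prio_eq T T' i j : task_at T i = task_at T' i -> task_at T j = task_at T' j ->
  prio T i j = prio T' i j.
Proof. by rewrite /prio /key => -> ->. Qed.

Lemma cand_eq T T' E E' t i s : is_tap T -> is_tap T' ->
  nev_execution T E -> nev_execution T' E' ->
  truncation T t = truncation T' t -> s <= t ->
  fast_candidate T E i s -> fast_candidate T' E' i s.
Proof.
move=> + + + + + st.
(* Passing to preempting candidates reverses the implication and may exchange [T] and [T'], hence a
   measure symmetric in both. *)
have [n] := ubnP (rank T i + rank T' i).
elim: n T T' E E' i s st => // n IH T T' E E' i s st rn tT tT' nE nE' TT'.
move=> /(cand_rec tT nE)[ais mi nP]; apply/(cand_rec tT' nE').
have [ais' ei] := arrived_eq tT tT' TT' st ais; split => //; last first.
  by move=> s' s's /(opt_safe_eq tT' tT (esym TT') (le_trans s's st)); exact: nP.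
rewrite -ei; move: mi; congr (_ < _); apply: measure_within_ext => s' _ /ltW s's.
have s't := le_trans s's st.
split=> H j ji cj; have [[aj _] _] := cj.
- have [aj' ej] := arrived_eq tT' tT (esym TT') s't aj.
  have ji' : prio T j i by rewrite (prio_eq (esym ej) ei).
  apply: (H j ji'); apply: (IH T' T E' E) cj => //.
  rewrite -ltnS addnC; apply: leq_trans rn; rewrite ltnS -addnS; apply: leq_add.
    by apply: ltnW; apply: rank_lt => //; case: aj'.
  by apply: rank_lt => //; case: aj.
- have [aj' ej] := arrived_eq tT tT' TT' s't aj.
  have ji' : prio T' j i by rewrite -(prio_eq ej ei).
  apply: (H j ji'); apply: (IH T T' E E') cj => //.
  rewrite -ltnS; apply: leq_trans rn; rewrite ltnS -addnS; apply: leq_add.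
    by apply: ltnW; apply: rank_lt => //; case: aj.
  by apply: rank_lt => //; case: aj'.
Qed.

Lemma fast_run_eq T T' E E' t i s : is_tap T -> is_tap T' ->
  nev_execution T E -> nev_execution T' E' ->
  truncation T t = truncation T' t -> s <= t ->
  E Fast s = Some i -> E' Fast s = Some i.
Proof.
move=> tT tT' nE nE' TT' st /(fast_runE nE)[ci H]; apply/(fast_runE nE').
split; first exact: cand_eq TT' st ci.
move=> j ji cj; have cj' := cand_eq tT' tT nE' nE (esym TT') st cj; apply: H cj'.
have [[ai _] _] := ci; have [_ ei] := arrived_eq tT tT' TT' st ai.
have [[aj _] _] := cj; have [_ ej] := arrived_eq tT' tT (esym TT') st aj.
by rewrite (prio_eq (esym ej) ei).
Qed.

Lemma starts_slow_eq T T' E E' t i s : is_tap T -> is_tap T' ->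
  nev_execution T E -> nev_execution T' E' ->
  truncation T t = truncation T' t -> s <= t ->
  starts_slow T E i s -> starts_slow T' E' i s.
Proof.
move=> tT tT' nE nE' TT' st /(starts_slowE tT nE)[Ps nP ws].
apply/(starts_slowE tT' nE'); split; first exact: (opt_safe_eq tT tT' TT' st Ps).
  by move=> s' s's /(opt_safe_eq tT' tT (esym TT') (le_trans (ltW s's) st)); apply: nP.
have [_ <-] := arrived_eq tT tT' TT' st Ps.1.
move: ws; congr (_ < _); apply: measure_within_ext => s' _ /ltW s's.
have s't := le_trans s's st.
split; first exact: fast_run_eq TT' s't.
exact: fast_run_eq (esym TT') s't.
Qed.

Lemma run_eq T T' E E' t m i s : is_tap T -> is_tap T' ->
  nev_execution T E -> nev_execution T' E' ->
  truncation T t = truncation T' t -> s <= t ->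
  E m s = Some i -> E' m s = Some i.
Proof.
move=> tT tT' nE nE' TT' st; case: m => [|k]; first exact: fast_run_eq TT' st.
move=> /(slow_runE nE)[-> rs]; apply/(slow_runE nE'); split => //.
have [_ [a as_ Sa]] := rs.
have Sa' := starts_slow_eq tT tT' nE nE' TT' (le_trans as_ st) Sa.
move/(running_slowE tT nE _ Sa): rs => H; apply/(running_slowE tT' nE' _ Sa').
have [_ <-] // := arrived_eq tT tT' TT' (le_trans as_ st) (starts_slow_opt_safe Sa).1.
Qed.

Lemma nev_online (A : scheduler R) : is_nev A -> online A.
Proof.
move=> nA T T' t tT tT' TT' s st.
have nE := nA T tT; have nE' := nA T' tT'; split => [m|i].
  case Em : (A T m s) => [i|]; first by rewrite (run_eq tT tT' nE nE' TT' st Em).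
  case Em' : (A T' m s) => [i|] //.
  by rewrite (run_eq tT' tT nE' nE (esym TT') st Em') in Em.
rewrite !cancelE; try exact: nA.
split; first exact: starts_slow_eq TT' st.
exact: starts_slow_eq (esym TT') st.
Qed.

End NevOnline.

(** * Sums and extrema over selected indices *)

Section FiniteSelections.
Context {R : realType}.
Implicit Types (r : seq nat) (P Q : pred nat) (F : nat -> R).

Lemma ler_sum_sub r P Q F : (forall j, j \in r -> P j -> Q j) ->
  (forall j, j \in r -> 0 <= F j) ->
  \sum_(j <- r | P j) F j <= \sum_(j <- r | Q j) F j.
Proof.
move=> PQ F0; rewrite big_mkcond [leRHS]big_mkcond big_seq [leRHS]big_seq.
by apply: ler_sum => j jr; case: ifP => [/(PQ j jr) ->//|_]; case: ifP => // _; exact: F0.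
Qed.

Lemma ler_sum_seq r P F G : (forall j, j \in r -> P j -> F j <= G j) ->
  \sum_(j <- r | P j) F j <= \sum_(j <- r | P j) G j.
Proof.
move=> FG; rewrite big_seq_cond [leRHS]big_seq_cond.
by apply: ler_sum => j /andP[]; exact: FG.
Qed.

Lemma ler_term_sum r P F i : i \in r -> P i -> (forall j, j \in r -> 0 <= F j) ->
  F i <= \sum_(j <- r | P j) F j.
Proof.
move=> ir Pi F0; rewrite (big_rem i)//= Pi lerDl big_seq_cond.
by apply: sumr_ge0 => j /andP[/mem_rem jr _]; exact: F0.
Qed.

Lemma exists_min_seq r P F : (exists2 i, i \in r & P i) ->
  exists i, [/\ i \in r, P i & forall j, j \in r -> P j -> F i <= F j].
Proof.
elim: r => [[]//|k r IH] [i ir Pi].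
have [/IH [l [lr Pl lmin]]|nr] := pselect (exists2 i, i \in r & P i).
  have [lk|kl] := boolP (P k ==> (F l <= F k)).
    exists l; split => //; first by rewrite inE lr orbT.
    move=> j; rewrite inE => /predU1P[-> Pk|]; [exact: (implyP lk)|exact: lmin].
  move: kl; rewrite negb_imply -ltNge => /andP[Pk kl].
  exists k; split => //; first by rewrite inE eqxx.
  move=> j; rewrite inE => /predU1P[->//|jr Pj].
  exact: le_trans (ltW kl) (lmin _ jr Pj).
move: ir; rewrite inE => /predU1P[ik|ir]; last by case: nr; exists i.
exists k; split; rewrite ?inE ?eqxx -?ik// => j; rewrite inE => /predU1P[->//|jr Pj].
by case: nr; exists j.
Qed.

(** Finiteness leaves a gap below [D]. For arrival times, this is a time before [D] at which all
    selected tasks are known. *)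
Lemma exists_ub_lt r P F (D : R) : (forall j, j \in r -> P j -> F j < D) ->
  exists2 a, a < D & forall j, j \in r -> P j -> F j <= a.
Proof.
elim: r => [_|k r IH H]; first by exists (D - 1) => //; lra.
have [j jr|a aD Ha] := IH; first by apply: H; rewrite inE jr orbT.
have [Pk|nPk] := boolP (P k).
  exists (Num.max a (F k)); first by rewrite gt_max aD H// inE eqxx.
  move=> j; rewrite inE => /predU1P[-> _|jr Pj]; rewrite le_max ?lexx ?orbT//.
  by rewrite Ha.
exists a => // j; rewrite inE => /predU1P[-> Pk|]; last exact: Ha.
by rewrite Pk in nPk.
Qed.

End FiniteSelections.

(** * Remaining fast work compared with the optimum *)

Section Competitive.
Context {R : realType}.
Variables (T : seq (task R)) (E : execution R).
Hypotheses (tT : is_tap T) (nE : nev_execution T E).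
Implicit Types (s t a b c : R) (i j k : nat) (P Q : pred nat).

Local Notation sigma i := (slow_runtime (task_at T i)).
Local Notation pie i := (fast_runtime (task_at T i)).
Local Notation arr i := (arrival (task_at T i)).
Local Notation cand := (fast_candidate T E).
Local Notation mfast := (measurable_fast_set E).
Local Notation tasks := (iota 0 (size T)).

Definition remaining i t : R := pie i - fast_work E i t.

Lemma remaining_ge0 i t : i \in tasks -> 0 <= remaining i t.
Proof. by rewrite mem_iota subr_ge0 => iT; exact: fast_work_le. Qed.

Lemma remaining_le i s t : s <= t -> remaining i t <= remaining i s.
Proof. by move=> st; rewrite lerD2l lerN2; exact: fast_work_mono. Qed.

Lemma cand_mem i t : cand i t -> i \in tasks.
Proof. by rewrite mem_iota => -[[[]]]. Qed.

Lemma cand_arr i t : cand i t -> arr i <= t.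
Proof. by move=> [[[]]]. Qed.

(** On a slow machine the task could not finish before its key, which is at least [K] and so beyond
    [c]. *)
Lemma fast_of_key_gt t K S c : valid_schedule (truncation T t) S -> c < K ->
  (forall i, (i < size (truncation T t))%N ->
    exists m, ((runtime (truncation T t) m i)%:E <= work_by S m i c)%E) ->
  forall j, arrived T j t -> K <= key T j ->
  pie j <= measure_within [set s | S Fast s = Some j] (arr j) c /\ arr j <= c.
Proof.
move=> vS cK H j aj Kj; have jT' := (size_truncation t j tT).2 aj.
have tT' := tap_truncation t tT; have [s0 p0 a0] := tap_runtimes tT aj.1.
have [m Hm] := H j jT'; have := arrival_runtime_le tT' vS jT' Hm.
case: m Hm => [|k] /=; rewrite task_at_truncation//; last first.
  by move=> _; move: Kj; rewrite /key; lra.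
rewrite (work_by_within _ _ vS jT') task_at_truncation// lee_fin => Hm ac.
by split => //; lra.
Qed.

(* From [u] on, where [u] is the start of the current period during which some
   task with key at least [K] is always a candidate, the fast machine has only
   run tasks with key at least [K] that arrived after [u], and a schedule
   completing before [K] has to run all of these on the fast machine too. *)
Lemma sum_remaining_le t K P i0 : (opt (truncation T t) < K%:E)%E -> P i0 ->
  (forall j, P j -> cand j t /\ K <= key T j) ->
  \sum_(j <- tasks | P j) remaining j t <= K - t.
Proof.
move=> /opt_lt [S [c [vS c0 cK Sc]]] Pi0 HP.
pose U l := [/\ (l < size T)%N, arr l <= t &
  forall s, arr l <= s -> s <= t -> exists2 j, cand j s & K <= key T j].
have exU : exists l, `[< U l >].
  have [ci0 Ki0] := HP _ Pi0; have [[ai0 _] _] := ci0.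
  exists i0; apply/asboolP; split; [by case: ai0|by case: ai0|].
  by move=> s as_ st; exists i0 => //; exact: (cand_le tT nE ci0).
(* Arrivals are sorted, so the least index gives the earliest start [u] of the period. *)
case: (ex_minnP exU) => l /asboolP [lT lt_ Hl] lmin.
set u := arr l in lt_ Hl.
have u0 : 0 <= u by have [] := tap_runtimes tT lT.
have candu j s : u <= s -> s <= t -> cand j s -> K <= key T j -> u <= arr j.
  move=> us st cj Kj; have [[[jT js] _] _] := cj.
  rewrite leNgt; apply/negP => ju.
  (* A candidate with large key that arrived before [u] would extend the period backwards. *)
  have /lmin : `[< U j >].
    apply/asboolP; split => //; first exact: le_trans st.
    move=> s' js' s't; have [s's|ss'] := leP s' s.
      by exists j => //; exact: (cand_le tT nE cj).
    by apply: Hl => //; exact: le_trans us (ltW ss').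
  by move=> lj; move: ju; rewrite ltNge tap_arrival_le.
pose Q j := [&& K <= key T j, u <= arr j & arr j <= t].
have busy : t - u <= \sum_(j <- tasks | Q j) fast_work E j t.
  rewrite (eq_bigr (fun j => measure_within (fast_set E j) u t)); last first.
    by move=> j /and3P[_ uj _]; exact: fast_work_from uj.
  apply: (fast_work_busy nE) => // s us st; have [j cj Kj] := Hl s us (ltW st).
  have [k Ek kj] := fast_busy nE cj; exists k => //.
  have ck := fast_run_cand nE Ek.
  have Kk : K <= key T k by case: kj => [->//|/prio_key]; exact: le_trans.
  rewrite /Q Kk (candu k s us (ltW st) ck Kk) /=.
  by apply: le_trans (ltW st); exact: cand_arr ck.
have lc : u <= c.
  have [j cj Kj] := Hl t lt_ (lexx t).
  have uj := candu j t lt_ (lexx t) cj Kj.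
  have [[aj _] _] := cj.
  by have [_] := fast_of_key_gt vS cK Sc aj Kj; exact: le_trans.
(* The tasks in [Q] have arrived by [t], so [S] schedules them all, on its fast machine and between
   [u] and [c]. *)
have pack : \sum_(j <- tasks | Q j) pie j <= c - u.
  apply: (@le_trans _ _ (\sum_(j <- tasks | Q j)
      measure_within [set s | S Fast s = Some j] u c)); last first.
    apply: le_trans (measure_within_le_len (@measurableT _ _) lc).
    apply: measure_within_pack => //; first exact: iota_uniq.
      by move=> j; exact: run_measurable.
    by move=> i j s /= -> [].
  apply: ler_sum_seq => j; rewrite mem_iota => jT /and3P[Kj uj jt].
  have aj : arrived T j t by split.
  have [Hj _] := fast_of_key_gt vS cK Sc aj Kj.
  rewrite (@measure_within_shift _ _ u (arr j))//; first exact: run_measurable.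
  move=> s sj /= Sj; have [v1 _ _] := vS; have [_] := v1 _ _ _ Sj.
  by rewrite task_at_truncation// leNgt sj.
apply: (@le_trans _ _ (\sum_(j <- tasks | Q j) remaining j t)).
  apply: ler_sum_sub => j jT; last exact: remaining_ge0.
  move=> /HP[cj Kj]; rewrite /Q Kj (candu j t lt_ (lexx t) cj Kj) /=.
  exact: cand_arr cj.
(* Subtracting [busy] from [pack] leaves [(c - u) - (t - u)], which is less than [K - t]. *)
rewrite /remaining big_split /= sumrN; lra.
Qed.

(** * The bound when the optimum is finite *)

Variable C : R.
Hypothesis optC : opt T = C%:E.

Definition copt t : R := fine (opt (truncation T t)).

Lemma optE t : opt (truncation T t) = (copt t)%:E.
Proof.
rewrite /copt fineK// ge0_fin_numE ?opt_ge0//.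
by apply: le_lt_trans (opt_truncation_le t tT) _; rewrite optC ltry.
Qed.

Lemma copt_ge0 t : 0 <= copt t.
Proof. by rewrite -lee_fin -optE opt_ge0. Qed.

Lemma copt_le t : copt t <= C.
Proof. by rewrite -lee_fin -optE -optC opt_truncation_le. Qed.

Lemma copt_mono s t : s <= t -> copt s <= copt t.
Proof. by move=> st; rewrite -lee_fin -!optE opt_truncation_mono. Qed.

Lemma arr_leC i : (i < size T)%N -> arr i <= C.
Proof. by move=> iT; rewrite -lee_fin -optC arrival_le_opt. Qed.

Lemma coptC t : C <= t -> copt t = C.
Proof.
move=> Ct; apply: EFin_inj; rewrite -optE truncation_last// => i /arr_leC.
by move/le_trans; apply.
Qed.

Lemma C_ge0 : 0 <= C.
Proof. by rewrite -lee_fin -optC opt_ge0. Qed.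

Lemma cand_unsafe i s t : cand i t -> arr i <= s -> s <= t ->
  3 / 2 * copt s < sigma i + s.
Proof.
move=> ci as_ st; have [[[iT _] _] _] := ci.
have /(candE tT nE) [_ _ /(_ s st) nP] := ci.
by rewrite ltNge; apply/negP => H; apply: nP; split => //; rewrite optE -EFinM lee_fin.
Qed.

Lemma cand_opt_key i : cand i C -> key T i <= C.
Proof.
move=> ci; rewrite leNgt; apply/negP => Ci.
have iT := cand_mem ci.
have r0 : 0 < remaining i C by rewrite subr_gt0; have /(candE tT nE)[] := ci.
(* [K] lies above the optimum but by at most half of what remains of [i], so the bound [K - C] on
   that remainder is contradictory. *)
pose K := Num.min (key T i) (C + remaining i C / 2).
have CK : C < K by rewrite /K lt_min Ci /=; lra.
have Ki : K <= key T i by rewrite /K ge_min lexx.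
have Kr : K <= C + remaining i C / 2 by rewrite /K ge_min lexx orbT.
have := @sum_remaining_le C K (pred1 i) i; rewrite optE coptC// lte_fin /= eqxx.
have HP j : pred1 i j -> cand j C /\ K <= key T j by move/eqP ->.
move=> /(_ CK isT HP).
have := @ler_term_sum R tasks (pred1 i) (remaining^~ C) i iT (eqxx i).
by move=> /(_ (fun j => @remaining_ge0 j C)); lra.
Qed.

(** [D] is the first arrival time at which the optimum reaches the key of [i]. Being unsafe at [D]
    means [3/2 * copt D < sigma i + D], and [sigma i <= copt D - arr i] turns this into the lower
    bound on [D]. *)
Lemma first_nonfast i : cand i C -> exists D, [/\ D <= C, key T i <= copt D,
  copt D / 2 + arr i < D & forall s, arr i <= s -> s < D -> copt s < key T i].
Proof.
move=> ci; have [[ai _] _] := ci.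
have [||l [lT [al kl] lmin]] := @first_arrival _ T tT
    (fun s => arrived T i s /\ key T i <= copt s).
- move=> s [ais ks]; have [l [lT il ls e]] := last_arrival tT ais.
  exists l; split => //; split; first by split => //; case: ais.
  by move: ks; rewrite /copt e.
- by exists C; split => //; rewrite coptC// cand_opt_key.
exists (arr l); split => //; first exact: arr_leC.
  have := cand_unsafe ci al.2 (arr_leC lT).
  move: kl; rewrite /key; lra.
move=> s as_ sl; rewrite ltNge; apply/negP => H.
have /lmin : arrived T i s /\ key T i <= copt s by split => //; split => //; case: ai.
by rewrite leNgt sl.
Qed.

(** At [D] the optimum may already have reached the key, so [sum_remaining_le] is applied at times
    [t] just before [D], after all the selected arrivals. *)
Lemma sum_remaining_before i D P :
  (forall s, arr i <= s -> s < D -> copt s < key T i) -> D <= C ->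
  P i -> (forall j, P j -> [/\ cand j C, key T i <= key T j & arr j < D]) ->
  \sum_(j <- tasks | P j) remaining j C <= key T i - D.
Proof.
move=> HD DC Pi HP; have [j _ /HP[]//|a aD Ha] := @exists_ub_lt R tasks P (fun j => arr j) D.
have [ci _ iD] := HP _ Pi.
rewrite leNgt; apply/negP; set w := \sum_(j <- _ | _) _ => H.
(* Half the supposed excess over [key T i - D] is close enough to [D] for a contradiction. *)
pose t := Num.max a (D - (w - (key T i - D)) / 2).
have tD : t < D by rewrite /t gt_max aD /=; lra.
have at_ : a <= t by rewrite /t le_max lexx.
have Dt : D - (w - (key T i - D)) / 2 <= t by rewrite /t le_max lexx orbT.
have arrt j : P j -> arr j <= t.
  move=> Pj; apply: le_trans at_; apply: Ha => //.
  by have [cj _ _] := HP _ Pj; exact: cand_mem cj.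
have : w <= key T i - t; last by lra.
apply: (@le_trans _ _ (\sum_(j <- tasks | P j) remaining j t)).
  by apply: ler_sum => j _; apply: remaining_le; lra.
apply: (@sum_remaining_le _ _ _ i) => //.
  by rewrite optE lte_fin; apply: HD => //; exact: arrt.
move=> j Pj; have [cj kj jD] := HP _ Pj; split => //.
by apply: (cand_le tT nE cj); [exact: arrt|lra].
Qed.

Lemma sum_remaining_opt (Z := fun j => `[< cand j C >]) :
  \sum_(j <- tasks | Z j) remaining j C <= C / 2.
Proof.
have C0 := C_ge0.
have ZP j : Z j -> cand j C by move/asboolP.
have empty (P : pred nat) : ~ (exists2 i, i \in tasks & P i) ->
    \sum_(j <- tasks | P j) remaining j C = 0.
  by move=> nP; rewrite big_seq_cond big1// => j /andP[jT Pj]; case: nP; exists j.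
have [exZ|/empty ->] := pselect (exists2 i, i \in tasks & Z i); last by lra.
have [i [iT Zi imin]] := exists_min_seq (key T) exZ.
have [D [DC kD aD HD]] := first_nonfast (ZP _ Zi).
have oldle : \sum_(j <- tasks | Z j && (arr j < D)) remaining j C <= key T i - D.
  apply: sum_remaining_before => //.
    by rewrite Zi /=; have := copt_ge0 D; lra.
  move=> j /andP[Zj jD]; split => //; first exact: ZP.
  by apply: imin => //; exact: cand_mem (ZP _ Zj).
have iC := copt_le D; have [_ _ a0] := tap_runtimes tT (ZP _ Zi).1.1.1.
(* The first two generations: the waiting tasks that arrived before [D] and those that arrived from
   [D] on. *)
rewrite (bigID (fun j => arr j < D)) /=.
have [exN|/empty ->] := pselect (exists2 i, i \in tasks & Z i && ~~ (arr i < D)); last first.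
  by rewrite addr0; lra.
have [i1 [i1T /andP[Zi1 i1D] i1min]] := exists_min_seq (key T) exN.
rewrite -leNgt in i1D.
have [D1 [D1C kD1 aD1 HD1]] := first_nonfast (ZP _ Zi1).
have fresh j : Z j -> 3 / 2 * copt (arr j) < key T j.
  move=> /ZP cj; have := cand_unsafe cj (lexx _) (cand_arr cj).
  by rewrite /key.
have kiC : C / 2 < key T i.
  have := cand_unsafe (ZP _ Zi) (cand_arr (ZP _ Zi)) (lexx C).
  by rewrite coptC// /key; lra.
have newle : \sum_(j <- tasks | Z j && ~~ (arr j < D)) remaining j C <= key T i1 - D1.
  apply: sum_remaining_before => //.
    by rewrite Zi1 -leNgt.
  move=> j Nj; have /andP[Zj jD] := Nj; have cj := ZP _ Zj; split => //.
    by apply: i1min => //; exact: cand_mem cj.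
  (* A third-generation key would exceed [3/2 * copt D1], hence [9/4 * copt D], hence [9/8 * C],
     against [cand_opt_key]. *)
  rewrite ltNge; apply/negP => D1j.
  have := fresh _ Zj; have := fresh _ Zi1; have := copt_mono D1j.
  have := copt_mono i1D; have := cand_opt_key cj; lra.
(* With [D1 > copt D1 / 2 + D], the two bounds add up to at most [copt D - 2 * D + copt D1 / 2], and
   [2 * D > copt D]. *)
have := copt_le D1; lra.
Qed.

Lemma fast_work_done i : (i < size T)%N -> ~ (exists a, starts_slow T E i a) ->
  pie i <= fast_work E i (3 / 2 * C).
Proof.
move=> iT ns; have C0 := C_ge0; set t := 3 / 2 * C.
have Ct : C <= t by rewrite /t; lra.
have ait : arrived T i t by split => //; exact: le_trans (arr_leC iT) Ct.
have [ci|//|[a _ Sa]] := cand_or tT nE ait; last by case: ns; exists a.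
exfalso.
pose Z j := `[< cand j C >].
have wi : 0 < remaining i t by rewrite subr_gt0; have /(candE tT nE)[] := ci.
(* No task arrives after [C], so if [i] still waits at [t], the machine has spent [C / 2] on tasks
   waiting at [C]; together with the positive remainder of [i] this exceeds [sum_remaining_opt]. *)
have busy : t - C <= \sum_(j <- tasks | Z j) measure_within (fast_set E j) C t.
  apply: (fast_work_busy nE) => // s Cs st.
  have cis : cand i s.
    by apply: (cand_le tT nE ci); [exact: le_trans (arr_leC iT) Cs|exact: ltW].
  have [k Ek _] := fast_busy nE cis; exists k => //.
  have ck := fast_run_cand nE Ek; apply/asboolP.
  by apply: (cand_le tT nE ck) => //; apply: arr_leC; case: ck => -[[]].
have : \sum_(j <- tasks | Z j) measure_within (fast_set E j) C t =
    \sum_(j <- tasks | Z j) remaining j C - \sum_(j <- tasks | Z j) remaining j t.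
  rewrite -sumrB; apply: eq_bigr => j _; rewrite /remaining /fast_work.
  rewrite (measure_within_split (mfast j) C0 Ct); lra.
have : remaining i t <= \sum_(j <- tasks | Z j) remaining j t.
  apply: ler_term_sum; [exact: cand_mem ci| |by move=> j; exact: remaining_ge0].
  by apply/asboolP/(cand_le tT nE ci) => //; exact: arr_leC.
have := sum_remaining_opt; rewrite -/Z /t in busy *; lra.
Qed.

(** A slow run started at [a] ends by [3/2 * copt a], at most [3/2 * C]. The other tasks are never
    cancelled, so all their fast work survives. *)
Lemma nev_completion_time :
  (completion_time T (surviving E) <= (3 / 2 * C)%:E)%E.
Proof.
have C0 := C_ge0; apply: ereal_inf_lbound; exists (3 / 2 * C) => //.
split; first by lra.
move=> i iT; have [s0 p0 a0] := tap_runtimes tT iT.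
have [[a Sa]|ns] := pselect (exists a, starts_slow T E i a).
  exists (Slow i); have [_ +] := starts_slow_opt_safe Sa.
  rewrite optE -EFinM lee_fin => Ha; have := copt_le a => aC.
  rewrite /work_by (_ : mkset _ = `[a, a + sigma i[%classic).
    by rewrite lebesgue_measure_itv /= lte_fin ltrDl s0 -EFinB addrC addKr.
  apply/seteqP; split => s /=; rewrite in_itv /=.
    by move=> [_ /(surviving_runE nE) [/(slow_runE nE)[_ /(running_slowE tT nE _ Sa)]]].
  move=> H; split; first by case/andP: H => _ H2; apply: (lt_le_trans H2); have := Ha; lra.
  apply/(surviving_runE nE); split.
    by apply/(slow_runE nE); split => //; apply/(running_slowE tT nE _ Sa).
  by move=> c /(starts_slow_inj Sa) <-; case/andP: H.
exists Fast; have := fast_work_done iT ns; rewrite -lee_fin /= => /le_trans; apply.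
rewrite /fast_work -lebesgue_measure_setI_itv; last exact: mfast.
apply: le_measure; rewrite ?inE.
- by apply: measurableI => //; exact: mfast.
- rewrite (_ : mkset _ = `]-oo, (3 / 2 * C)[%classic `&` [set s | surviving E Fast s = Some i]).
    by apply: measurableI => //; exact: run_measurable.
  by apply/seteqP; split => s /=; rewrite in_itv.
- move=> s /= [Es]; rewrite in_itv /= => /andP[_ sC]; split => //.
  apply/(surviving_runE nE); split => // c Sc; case: ns; by exists c.
Qed.

End Competitive.

Lemma nev_competitive (R : realType) (A : scheduler R) : is_nev A ->
  competitive (3 / 2) A.
Proof.
move=> nA T tT; have := opt_ge0 T; case e : (opt T) => [C| |] // _.
  by rewrite -EFinM; apply: (nev_completion_time tT (nA T tT) e).
by rewrite gt0_muley ?lte_fin// leey.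
Qed.

(** * Existence of a nev execution *)

Section Existence.
Context {R : realType}.
Variable T : seq (task R).
Hypothesis tT : is_tap T.
Implicit Types (s t a b : R) (i j k : nat).

Local Notation sigma i := (slow_runtime (task_at T i)).
Local Notation pie i := (fast_runtime (task_at T i)).
Local Notation arr i := (arrival (task_at T i)).

Lemma cand_rule_ext (c c' : nat -> R -> Prop) i t :
  (forall j s, prio T j i -> c j s <-> c' j s) ->
  cand_rule T c i t <-> cand_rule T c' i t.
Proof.
move=> cc'; rewrite /cand_rule (_ : unpreempted T c i = unpreempted T c' i)//.
by apply/seteqP; split => s /= H j ji /(cc' j s ji); exact: H.
Qed.

(** The rule for a task involves only tasks of smaller rank, so the equation is solved by recursion
    on the rank. The first two properties are carried along because they make [unpreempted]
    measurable. *)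
Lemma cand_rule_fixpoint : exists c : nat -> R -> Prop,
  [/\ forall j t, c j t -> arrived T j t,
    forall j s t, c j t -> arr j <= s -> s <= t -> c j s
  & forall i t, c i t <-> cand_rule T c i t].
Proof.
suff [c [c1 c2 c3]] : exists c : nat -> R -> Prop,
    [/\ forall j t, c j t -> arrived T j t,
      forall j s t, c j t -> arr j <= s -> s <= t -> c j s
    & forall i t, (rank T i < (size T).+1)%N -> c i t <-> cand_rule T c i t].
  exists c; split => // i t; apply: c3.
  by rewrite ltnS -[X in (_ <= X)%N](size_iota 0); exact: count_size.
elim: (size T).+1 => [|n [c [c1 c2 c3]]]; first by exists (fun _ _ => False).
(* Ranks below [n] are settled; applying the rule to all other tasks settles rank [n]. *)
exists (fun i => if (rank T i < n)%N then c i else cand_rule T c i).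
have mU i : measurable (unpreempted T c i) by exact: measurable_unpreempted.
split.
- by move=> j t; case: ifP => _; [exact: c1|case].
- move=> j s t; case: ifP => _; first exact: c2.
  move=> [[jT _] mt nP] js st; split => //.
    by apply: le_lt_trans mt; exact: measure_within_le.
  by move=> s' s's; apply: nP; exact: le_trans st.
- move=> i t; rewrite ltnS => rin.
  have e : cand_rule T c i t <-> cand_rule T
      (fun j => if (rank T j < n)%N then c j else cand_rule T c j) i t.
    apply: cand_rule_ext => j s ji.
    (* Indices beyond the list, not covered by [rank_lt], are candidates on neither side. *)
    have [jT|Tj] := ltnP j (size T); first by rewrite (leq_trans (rank_lt jT ji) rin).
    case: ifP => // _; split => [/c1[]|[[]]]; by rewrite ltnNge Tj.
  by rewrite -e; case: ifP => // rn; exact: c3.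
Qed.

(** * The execution built from a solution of the candidate equation *)

Section Model.
Variable c : nat -> R -> Prop.
Hypotheses (c_arr : forall j t, c j t -> arrived T j t)
  (c_le : forall j s t, c j t -> arr j <= s -> s <= t -> c j s)
  (cE : forall i t, c i t <-> cand_rule T c i t).

Local Notation free i := (unpreempted T c i).

Definition nev_choice i s := c i s /\ forall j, prio T j i -> ~ c j s.

(** The right-hand side of [starts_slowE], with free machine time in place of the fast work, which
    presupposes an execution. *)
Definition nev_start i a := [/\ opt_safe T i a, forall s, s < a -> ~ opt_safe T i s
  & measure_within (free i) (arr i) a < pie i].

Lemma nev_choice_inj i j s : nev_choice i s -> nev_choice j s -> i = j.
Proof.
by move=> [ci ni] [cj nj]; have [//|/nj|/ni] := prio_total T i j.
Qed.

Lemma nev_start_inj i a b : nev_start i a -> nev_start i b -> a = b.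
Proof.
move=> [Pa na _] [Pb nb _]; case: (ltgtP a b) => // ab.
  by have := nb _ ab.
by have := na _ ab.
Qed.

Definition nev_run (m : machine) (s : R) : option nat :=
  match m with
  | Fast => if pselect (exists i, nev_choice i s) is left H
            then Some (projT1 (cid H)) else None
  | Slow k => if `[< exists2 a, nev_start k a & a <= s < a + sigma k >]
              then Some k else None
  end.

Lemma nev_run_fast i s : nev_run Fast s = Some i <-> nev_choice i s.
Proof.
rewrite /nev_run; case: pselect => [H|H]; split => //.
- by case=> <-; exact: projT2 (cid H).
- by move=> ci; congr Some; exact: nev_choice_inj (projT2 (cid H)) ci.
- by move=> ci; case: H; exists i.
Qed.

Lemma nev_run_slow k i s : nev_run (Slow k) s = Some i <->
  k = i /\ exists2 a, nev_start i a & a <= s < a + sigma i.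
Proof.
rewrite /nev_run; case: asboolP => H; split => //; first by case=> <-.
  by case=> ->.
by case=> e; rewrite -e => /H.
Qed.

Lemma measurable_free i : measurable (free i).
Proof. exact: measurable_unpreempted. Qed.

Lemma nev_run_measurable m i : measurable [set s : R | nev_run m s = Some i].
Proof.
case: m => [|k].
  rewrite (_ : mkset _ = [set s | c i s] `&` free i); last first.
    by apply/seteqP; split => s /=; rewrite nev_run_fast.
  apply: measurableI; last exact: measurable_free.
  apply: measurable_realfun.is_interval_measurable => x y /= cx cy z /andP[xz zy].
  by apply: c_le cy _ zy; apply: le_trans xz; have [] := c_arr cx.
have [[-> [a Sa]]|H] := pselect (k = i /\ exists a, nev_start i a).
  rewrite (_ : mkset _ = `[a, a + sigma i[%classic)//.
  apply/seteqP; split => s /=; rewrite nev_run_slow in_itv /=.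
    by move=> [_ [b /(nev_start_inj Sa) <-]].
  by split => //; exists a.
rewrite (_ : mkset _ = set0) ?measurable0//; apply/seteqP; split => s //=.
by rewrite nev_run_slow => -[ki [a Sa _]]; apply: H; split => //; exists a.
Qed.

Definition nev_model : execution R :=
  Execution (Schedule nev_run_measurable) (fun i => [set a | nev_start i a]).

Local Notation E := nev_model.
Local Notation work := (fast_work nev_model).

Lemma fast_work_le_free i t : (i < size T)%N ->
  work i t <= measure_within (free i) (arr i) t.
Proof.
move=> iT; have [_ _ a0] := tap_runtimes tT iT; have mf := measurable_fast_set E i.
rewrite /fast_work (measure_within_shift _ mf a0); last first.
  move=> s si /nev_run_fast [/c_arr [_ is_] _].
  by move: si; rewrite ltNge is_.
apply: measure_within_sub => //; first exact: measurable_free.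
by move=> s _ _ /nev_run_fast[].
Qed.

(* As long as it is not safe on a slow machine, task [i] is a candidate, hence
   runs whenever the machine is free, until it is completed. *)
Lemma fast_work_free i b : (i < size T)%N -> (forall s, s < b -> ~ opt_safe T i s) ->
  pie i <= measure_within (free i) (arr i) b -> pie i <= work i b.
Proof.
move=> iT nP H; have [_ p0 a0] := tap_runtimes tT iT; have mf := measurable_free i.
have ab : arr i <= b.
  rewrite leNgt; apply/negP => ba.
  by move: H; rewrite measure_within_empty ?(ltW ba)// leNgt p0.
have [|||z /andP[az zb] [Hz Hlt]] :=
    @first_hit R (measure_within (free i) (arr i)) (arr i) b (pie i) _ ab.
- move=> x y ax xy yb; rewrite measure_within_le//= (measure_within_split mf ax xy).
  by rewrite lerD2l measure_within_le_len.
- by rewrite measure_within_empty.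
- by [].
have mE := measurable_fast_set E i.
rewrite -Hz /fast_work (measure_within_split mE a0 ab).
apply: (@le_trans _ _ (measure_within (fast_set E i) (arr i) b)); last first.
  by rewrite lerDr measure_within_ge0.
apply: le_trans (measure_within_le (arr i) mE zb).
apply: measure_within_sub => // s as_ sz fs; apply/nev_run_fast; split => //.
apply/cE; split => //; first exact: Hlt.
by move=> s' s's; apply: nP; exact: le_lt_trans s's (lt_le_trans sz zb).
Qed.

Lemma completed_nev_nostart i t : (i < size T)%N ->
  (forall a, nev_start i a -> t <= a) -> completed T E i t <-> pie i <= work i t.
Proof.
move=> iT Hc; have [_ _ a0] := tap_runtimes tT iT; apply: completed_uncancelled => //.
- by move=> s /nev_run_fast[/c_arr[_ is_] _]; exact: le_trans is_.
- move=> k s st /nev_run_slow [_ [a /Hc ta /andP[as_ _]]].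
  by move: (lt_le_trans st (le_trans ta as_)); rewrite ltxx.
Qed.

Lemma pending_nev_start i a t : nev_start i a -> a <= t ->
  pending T E i t <-> t < a + sigma i.
Proof.
move=> Sa; have [[[iT ia] _] nP fa] := Sa; have [s0 p0 a0] := tap_runtimes tT iT.
(* At [t = a] the cancellation does not yet count in [progress], so completion is still decided by
   the fast work. *)
rewrite le_eqVlt => /predU1P[<-|at_].
  split=> _; first by rewrite ltrDl.
  split => // /(completed_nev_nostart iT) H.
  have : pie i <= work i a by apply: H => b /(nev_start_inj Sa) ->.
  by rewrite leNgt (le_lt_trans (fast_work_le_free _ iT)).
pose X : set R := [set s | E (Slow i) s = Some i].
have mX : measurable X by exact: run_measurable.
have XE s : X s <-> a <= s < a + sigma i.
  split=> [/nev_run_slow[_ [b /(nev_start_inj Sa) <-]]//|H].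
  by apply/nev_run_slow; split => //; exists a.
have complE : completed T E i t <-> sigma i <= measure_within X a t.
  apply: completed_cancelled => //.
  - by move=> b; split=> [/(nev_start_inj Sa)|->].
  - move=> s as_ /nev_run_fast[/cE[_ _ /(_ a as_)] + _]; apply.
    by case: Sa.
  - by move=> k s /nev_run_slow[].
split=> [[_ nc]|ta].
  rewrite ltNge; apply/negP => sat; apply: nc; apply/complE.
  apply: le_trans (measure_within_le a mX sat).
  rewrite measure_within_full ?lerDl ?(ltW s0)//; first by rewrite addrC addKr.
  by move=> s as_ sa; apply/XE; rewrite as_.
split; first by split => //; exact: le_trans (ltW at_).
move/complE; rewrite leNgt => /negP; apply.
by apply: le_lt_trans (measure_within_le_len mX (ltW at_)) _; rewrite ltrBlDl.
Qed.

(** Either the free time up to [a] was too short and the task moves, or it sufficed; then the task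
    used it and never moves. *)
Lemma nev_start_or i a : opt_safe T i a -> (forall s, opt_safe T i s -> a <= s) ->
  nev_start i a \/ pie i <= work i a /\ forall b, ~ nev_start i b.
Proof.
move=> Pa amin; have [iT _] := Pa.1.
have nP s : s < a -> ~ opt_safe T i s by move=> sa /amin; rewrite leNgt sa.
have [H|H] := leP (pie i) (measure_within (free i) (arr i) a); last by left.
right; split; first exact: fast_work_free.
move=> b [Pb nPb]; rewrite ltNge => /negP; apply.
by case: (ltgtP a b) => [/nPb//|/nP//|<-].
Qed.

Lemma starts_slow_nev i a : starts_slow T E i a <-> nev_start i a.
Proof.
have le1 b : nev_start i b -> starts_slow T E i b.
  move=> Sb; have [Pb nPb _] := Sb; have [iT _] := Pb.1; have [s0 _ _] := tap_runtimes tT iT.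
  split; last by move=> s sb [[as_ _] Hs]; exact: (nPb s sb).
  split; last by case: Pb.
  by apply/(pending_nev_start Sb); rewrite ?ltrDl.
split=> [Sa|]; last exact: le1.
have Pa : opt_safe T i a by case: Sa => -[[]].
have [b [Pb ba bmin]] := opt_safe_first tT Pa.
have [Sb|[Hb nob]] := nev_start_or Pb bmin.
  by rewrite (starts_slow_inj Sa (le1 _ Sb)).
(* The fast work was done by [b] and is never cancelled, so the task cannot be pending at [a]. *)
have [[[_ +] _] _] := Sa; case; apply/completed_nev_nostart; first by case: Pa => -[].
  by move=> b' /nob.
exact: le_trans Hb (fast_work_mono E i ba).
Qed.

Lemma running_slow_nev i t : running_slow T E i t <->
  exists2 a, nev_start i a & a <= t < a + sigma i.
Proof.
split=> [[pt [a at_ /starts_slow_nev Sa]]|[a Sa /andP[at_ ta]]].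
  by exists a => //; rewrite at_; apply/(pending_nev_start Sa).
split; first exact/(pending_nev_start Sa).
by exists a => //; apply/starts_slow_nev.
Qed.

Lemma fast_candidate_nev i t : fast_candidate T E i t <-> c i t.
Proof.
split=> [[pt nr]|ci].
  have [[iT it] nc] := pt.
  have nostart a : nev_start i a -> t < a.
    move=> Sa; rewrite ltNge; apply/negP => at_; apply: nr; apply/running_slow_nev.
    by exists a => //; rewrite at_; apply/(pending_nev_start Sa).
  have wt : work i t < pie i.
    rewrite ltNge; apply/negP => H; apply: nc; apply/completed_nev_nostart => //.
    by move=> a /nostart/ltW.
  have nP s : s <= t -> ~ opt_safe T i s.
    move=> st Ps; have [b [Pb bs bmin]] := opt_safe_first tT Ps.
    have bt := le_trans bs st.
    have [/nostart|[Hb _]] := nev_start_or Pb bmin.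
      by rewrite ltNge bt.
    by move: wt; rewrite ltNge (le_trans Hb)// fast_work_mono.
  apply/cE; split => //; rewrite ltNge; apply/negP => /(fast_work_free iT) H.
  by move: wt; rewrite ltNge H// => s /ltW/nP.
have /cE [ait ft nP] := ci; have [iT _] := ait.
have nostart a : nev_start i a -> t < a.
  by move=> [Pa _ _]; rewrite ltNge; apply/negP => /nP.
split; last by move/running_slow_nev => [a /nostart ta /andP[]]; rewrite leNgt ta.
split => // /(completed_nev_nostart iT) H.
have : pie i <= work i t by apply: H => a /nostart/ltW.
by rewrite leNgt (le_lt_trans (fast_work_le_free _ iT)).
Qed.

Lemma nev_model_nev : nev_execution T E.
Proof.
move=> t i; split.
- by rewrite starts_slow_nev.
- by move=> k; rewrite running_slow_nev; exact: nev_run_slow.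
- apply: (iff_trans (nev_run_fast i t)); rewrite fast_choiceE /nev_choice fast_candidate_nev.
  by split=> -[ci H]; split => // j /H nj; [move/fast_candidate_nev|move/fast_candidate_nev].
Qed.

End Model.

Lemma nev_execution_exists : exists E, nev_execution T E.
Proof.
by have [c [c1 c2 c3]] := cand_rule_fixpoint; exists (nev_model c1 c2); exact: nev_model_nev.
Qed.

End Existence.

(** The existence part ensures that the universal part is not vacuous. *)
Theorem theorem5p2 (R : realType) :
  (exists nev : scheduler R, is_nev nev) /\
  (forall nev : scheduler R, is_nev nev ->
     never_committing_scheduler nev /\ competitive (3 / 2) nev).
Proof.
split=> [|A nA]; last first.
  split; last exact: nev_competitive.
  by split; [exact: nev_online|move=> T tT; apply: nev_valid (nA T tT)].
(* A scheduler is a total function: lists that are not task arrival processes receive an idle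
   execution. *)
have idle (m : machine) (i : nat) : measurable [set t : R | (None : option nat) = Some i].
  by rewrite (_ : mkset _ = set0) ?measurable0//; apply/seteqP; split => s.
have ex T : exists E : execution R, is_tap T -> nev_execution T E.
  have [/nev_execution_exists [E nE]|ntT] := pselect (is_tap T); first by exists E.
  by exists (Execution (Schedule (run := fun _ _ => None) idle) (fun _ => set0)).
by exists (fun T => projT1 (cid (ex T))) => T; exact: projT2 (cid (ex T)).
Qed.
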